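(* Let $\mathcal{X}=\{X_t,\,t\in\mathbb{Z}\}$ be the ARH(1) process on the real separable Hilbert space $\mathbb{H}$ with autocorrelation operator $\rho$ described in the context, with lag-0 and lag-1 autocovariance operators $\mathscr{R}_0=\mathbb{E}[X_0\otimes X_0]$ and $\mathscr{R}_1=\mathbb{E}[X_1\otimes X_0]$, and put $\mathscr{R}_{-1}=\mathscr{R}_1^*$. Assume $\rho$ is Hilbert--Schmidt and $\operatorname{Ker}(\mathscr{R}_0)=\{0\}$. Let $1\le p\le\infty$ and suppose that the following source condition holds for this $p$: there exist $w\in\mathcal{L}(\mathbb{H})$ and a constant $M>0$ such that $$\mathscr{R}_{-1}=\mathscr{R}_0\mathscr{R}_0\,w,\qquad \|w\|_p\le M.$$ For each $n$, let $\hat{\mathscr{R}}_0=\hat{\mathscr{R}}_{0,n}$ and $\hat{\mathscr{R}}_1=\hat{\mathscr{R}}_{1,n}$ be estimators (random operators on $\mathbb{H}$) of $\mathscr{R}_0$ and $\mathscr{R}_1$, with $\hat{\mathscr{R}}_0$ self-adjoint (not necessarily nonnegative definite) and in $\mathcal{S}_p$, and $\hat{\mathscr{R}}_1\in\mathcal{S}_2$. Assume that, for a sequence of positive numbers $\gamma_n\to 0$, as $n\to\infty$, $$\|\hat{\mathscr{R}}_0-\mathscr{R}_0\|_p^2=O_{\mathbb{P}}(\gamma_n),\qquad \|\hat{\mathscr{R}}_1-\mathscr{R}_1\|_p^2=O_{\mathbb{P}}(\gamma_n).$$ For $\alpha>0$ let $\hat{\Phi}_\alpha=(\hat{\mathscr{R}}_0\hat{\mathscr{R}}_0+\alpha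 I)^{-1}\hat{\mathscr{R}}_0\,\hat{\mathscr{R}}_1^*$. Then, for a sequence $\alpha_n>0$, $$\|\hat{\Phi}_{\alpha_n}-\rho^*\|_p^2=\|\hat{\Phi}_{\alpha_n}^*-\rho\|_p^2=O_{\mathbb{P}}\left(\frac{\gamma_n}{\alpha_n^3}+\alpha_n\right).$$ If in addition $\alpha_n\sim\gamma_n^{1/4}$ (that is, $\alpha_n/\gamma_n^{1/4}\to 1$ as $n\to\infty$), then $$\|\hat{\Phi}_{\alpha_n}-\rho^*\|_p^2=\|\hat{\Phi}_{\alpha_n}^*-\rho\|_p^2=O_{\mathbb{P}}\left(\gamma_n^{1/4}\right).$$
   Context: Setting. $\mathbb{H}$ is a real separable Hilbert space with inner product $\langle\cdot,\cdot\rangle_{\mathbb{H}}$ and norm $\|\cdot\|_{\mathbb{H}}$; $\mathcal{L}(\mathbb{H})$ is the space of bounded linear operators on $\mathbb{H}$ with operator norm $\|\cdot\|_\infty$; $I$ is the identity operator. For $u,v\in\mathbb{H}$, $u\otimes v$ is the operator $f\mapsto u\,\langle f,v\rangle_{\mathbb{H}}$. ARH(1) process. $\rho\in\mathcal{L}(\mathbb{H})$ satisfies $\sum_{j=0}^\infty\|\rho^j\|_\infty^2<\infty$; $\{\varepsilon_t\}_{t\in\mathbb{Z}}$ is a strong white noise on $\mathbb{H}$, i.e. i.i.d. $\mathbb{H}$-valued random elements with mean zero and $0<\mathbb{E}\|\varepsilon_0\|_{\mathbb{H}}^2<\infty$; and $\{X_t\}_{t\in\mathbb{Z}}$ is the unique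 stationary (zero-mean, square-integrable) solution of $X_t=\rho(X_{t-1})+\varepsilon_t$, $t\in\mathbb{Z}$. The operator $\mathscr{R}_0=\mathbb{E}[X_0\otimes X_0]$ is nonnegative definite, self-adjoint and trace-class, $\mathscr{R}_1=\mathbb{E}[X_1\otimes X_0]$, $\mathscr{R}_{-1}=\mathscr{R}_1^*=\mathbb{E}[X_0\otimes X_1]$, and these satisfy $\mathscr{R}_1=\rho\mathscr{R}_0$ and $\mathscr{R}_{-1}=\mathscr{R}_0\rho^*$. Schatten norms. For $1\le p<\infty$ and compact $\mathscr{T}\in\mathcal{L}(\mathbb{H})$, $\|\mathscr{T}\|_p=\big(\sum_{j}\langle e_j,(\mathscr{T}^*\mathscr{T})^{p/2}e_j\rangle_{\mathbb{H}}\big)^{1/p}$ for any complete orthonormal system $\{e_j\}$, and $\mathcal{S}_p$ is the set of compact $\mathscr{T}$ with $\|\mathscr{T}\|_p<\infty$; a bound $\|\mathscr{T}\|_p\le M$ with $p<\infty$ includes the assertion $\mathscr{T}\in\mathcal{S}_p$. For $p=\infty$, $\|\cdot\|_\infty$ is the operator norm and $\mathcal{S}_\infty$ is the set of compact operators (the operator $w$ in the source condition is, for $p=\infty$, only required to be bounded). $\mathcal{S}_2$ is the space of Hilbert--Schmidt operators. Estimator. $\hat{\Phi}_\alpha$ is the unique minimizer over $\Phi\in\mathcal{S}_2$ of the Tikhonov functional $\|\hat{\mathscr{R}}_1^*-\hat{\mathscr{R}}_0\Phi\|_2^2+\alpha\|\Phi\|_2^2$. Notation. For random variables $Z_n\ge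 0$ and positive numbers $a_n$, $Z_n=O_{\mathbb{P}}(a_n)$ means that for every $\epsilon>0$ there is $C<\infty$ with $\limsup_{n\to\infty}\mathbb{P}(Z_n>C a_n)\le\epsilon$. *)

(* Defs.v *)
From HB Require Import structures.
From mathcomp Require Import all_boot all_order all_algebra.
From mathcomp Require Import all_classical all_reals all_analysis.

Set Implicit Arguments.
Unset Strict Implicit.
Unset Printing Implicit Defensive.

Import Order.TTheory GRing.Theory Num.Theory.
Import numFieldNormedType.Exports.
Local Open Scope classical_set_scope.
Local Open Scope ring_scope.

HB.mixin Record CompleteNormedModule_isHilbert (R : realType) V
    & CompleteNormedModule R V := {
  inner : V -> V -> R ;
  innerC : forall x y, inner x y = inner y x ;
  inner_linearl : forall y, scalar (inner^~ y) ;
  inner_norm : forall x, inner x x = `|x| ^+ 2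
}.

#[short(type="hilbertType")]
HB.structure Definition Hilbert (R : realType) :=
  {V of CompleteNormedModule R V & CompleteNormedModule_isHilbert R V}.

Definition separable (T : topologicalType) :=
  exists2 D : set T, countable D & dense D.

Section operators.
Context {R : realType} {H : hilbertType R}.
Implicit Types (A B : H -> H) (E : set H) (p : \bar R).

Definition bounded_op A := linear A /\ continuous A.

(* Valued in \bar R: [+oo] when the linear map [A] is unbounded. *)
Definition opnorm A : \bar R :=
  ereal_sup [set `|A x|%:E | x in [set x : H | `|x| <= 1]].

(* The Hilbert space adjoint; exists and is unique for bounded [A]. *)
Definition adjoint A : H -> H :=
  fun y => get [set z | forall x, inner (A x) y = inner x z].

Definition selfadjoint A := forall x y, inner (A x) y = inner x (A y).

Definition compact_op A :=
  bounded_op A /\ compact (closure (A @` [set x : H | `|x| <= 1])).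

Definition tensor (u v : H) : H -> H := fun f => inner f v *: u.

(* Indexing the system by itself covers all dimensions uniformly. *)
Definition complete_orthonormal E :=
  [/\ forall e, E e -> `|e| = 1,
      forall e f, E e -> E f -> e <> f -> inner e f = 0
    & forall x, (forall e, E e -> inner x e = 0) -> x = 0].

(* Some complete orthonormal system of [H] (one always exists). *)
Definition onsystem : set H := get (complete_orthonormal : set (set H)).

(* [B] is the power [A ^ s] in the functional calculus of a compact nonnegative
   self-adjoint operator [A]: [A] is diagonalized by a complete orthonormal
   system of eigenvectors and [B] acts on it through the [s]-th powers of the
   eigenvalues. This determines [B], as [B] is bounded. *)
Definition is_op_power A (s : R) B :=
  bounded_op B /\
  exists E (lam : H -> R), complete_orthonormal E /\
    forall e, E e -> [/\ 0 <= lam e, A e = lam e *: e &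
                         B e = (lam e `^ s) *: e].

Definition op_power A (s : R) : H -> H :=
  get (is_op_power A s : set (H -> H)).

(* For finite exponents the value is [+oo] outside the Schatten class, so that
   [schatten p A <= M%:E] includes the membership of [A] in the class; for
   [p = +oo] it is the operator norm of any bounded operator. *)
Definition schatten p A : \bar R :=
  match p with
  | r%:E => if `[< compact_op A >] then
      (poweR (\esum_(e in onsystem)
         (inner e (op_power (adjoint A \o A) (r / 2) e))%:E) r^-1)%E
      else +oo%E
  | +oo%E => opnorm A
  | -oo%E => 0%E
  end.

Definition schatten_class p : set (H -> H) :=
  [set A | compact_op A /\ (schatten p A < +oo)%E].

(* [(A A + alpha I)^-1 A B^*]; [pinv setT] is the inverse of a bijective map. *)
Definition tikhonov (alpha : R) A B : H -> H :=
  pinv setT (A \o A + alpha *: (idfun : H -> H)) \o A \o adjoint B.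

End operators.

Arguments onsystem {R} H.
Arguments schatten {R H} p%_E A%_R.

Notation borel H := (g_sigma_algebraType (@open H)).

Section random_elements.
Context {d : measure_display} {T : measurableType d} {R : realType}
        (P : probability T R) {H : hilbertType R}.
Implicit Types (X Y Z : T -> H).

Definition random_element Y := measurable_fun setT (Y : T -> borel H).

Definition random_operator (A : T -> H -> H) :=
  (forall w, bounded_op (A w)) /\ (forall x, random_element (A ^~ x)).

(* The expectation of an integrable random element, through its inner products;
   on a separable Hilbert space this is the Bochner integral. *)
Definition is_mean Y (m : H) :=
  P.-integrable setT (fun w => `|Y w|%:E) /\
  forall v, 'E_P[fun w => inner (Y w) v]%E = (inner m v)%:E.

Definition mean Y : H := get (is_mean Y : set H).

(* [E[tensor Y Z]], evaluated pointwise on vectors. *)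
Definition crosscov Y Z : H -> H :=
  fun f => mean (fun w => tensor (Y w) (Z w) f).

Definition autocov (X : int -> T -> H) (h : int) : H -> H :=
  crosscov (X h) (X 0).

Definition identically_distributed (X : int -> T -> H) :=
  forall s t (B : set (borel H)), measurable B ->
    P (X s @^-1` B) = P (X t @^-1` B).

Definition mutually_independent (X : int -> T -> H) :=
  forall (J : seq int) (B : int -> set (borel H)), uniq J ->
    (forall t, measurable (B t)) ->
    P (\bigcap_(t in [set` J]) X t @^-1` B t) =
    (\prod_(t <- J) P (X t @^-1` B t))%E.

Record strong_white_noise (eps : int -> T -> H) : Prop := {
  wn_random : forall t, random_element (eps t) ;
  wn_ident : identically_distributed eps ;
  wn_indep : mutually_independent eps ;
  wn_mean : forall t, is_mean (eps t) 0 ;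
  wn_var : (0 < 'E_P[fun w => (`|eps 0 w| ^+ 2)%R] < +oo)%E
}.

(* Second order stationarity of a centered process. *)
Definition stationary (X : int -> T -> H) :=
  forall (s t h : int) (u v : H),
    'E_P[fun w => (inner (X (s + h) w) u * inner (X (t + h) w) v)%R]%E =
    'E_P[fun w => (inner (X s w) u * inner (X t w) v)%R]%E.

Record ARH1 (rho : H -> H) (eps X : int -> T -> H) : Prop := {
  arh_rho : bounded_op rho ;
  arh_summable : (\sum_(0 <= j <oo) opnorm (iter j rho) ^+ 2 < +oo)%E ;
  arh_noise : strong_white_noise eps ;
  arh_random : forall t, random_element (X t) ;
  arh_square : forall t, ('E_P[fun w => (`|X t w| ^+ 2)%R] < +oo)%E ;
  arh_mean : forall t, is_mean (X t) 0 ;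
  arh_stationary : stationary X ;
  arh_eq : forall t, {ae P, forall w, X t w = rho (X (t - 1) w) + eps t w}
}.

(* The outer measure [mu_ext P] agrees with [P] on measurable events; it is
   used so that the definition makes sense without measurability of [Z n]. *)
Definition bigO_P (Z : nat -> T -> \bar R) (a : nat -> R) :=
  forall e : R, 0 < e -> exists C : R,
    (limn_esup (fun n => mu_ext P [set w | (C * a n)%:E < Z n w]) <= e%:E)%E.

End random_elements.

(* Main.v *)
(** A bounded operator [A] has Schatten norm at most [C] iff it is compact and
    [sum_i |<A e_i, g_i>|^r <= C^r] for all finite Bessel families [e], [g]; the
    bound is attained at singular vectors, and holds in general because
    [|<e_i, u_k>| |<g_i, v_k>|] is a doubly substochastic matrix.  This
    description is symmetric under taking adjoints and yields the ideal property
    and, up to a factor [2], the triangle inequality.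

    Put [S = A A + alpha] with [A] the estimator of [R0], let [E0], [E1] be the
    errors of the two estimators, and recall that [rho^* = R0 w].  Then
    [Phi - rho^* = (S^-1 A) (E1^* - E0 rho^* ) - alpha (S^-1 A) w + alpha S^-1
      E0 w]
    where [|S^-1 A| <= 1 / sqrt alpha] and [|alpha S^-1| <= 1], so the squared
    error is of order [gamma / alpha + alpha + gamma].

    The identity [R1 = rho R0] comes from the recursion: the noise at time [1]
    is uncorrelated with [X 0], since by going back in time [X 0] is a
    combination of earlier noises plus [rho^k X_(-k)], which vanishes in mean
    square along a sequence of [k]. *)

Require Import Defs.
From HB Require Import structures.
From mathcomp Require Import all_boot all_order all_algebra.
From mathcomp Require Import all_classical all_reals all_analysis.
From mathcomp Require Import measurable_realfun ring lra.

Set Implicit Arguments.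
Unset Strict Implicit.
Unset Printing Implicit Defensive.

Import Order.TTheory GRing.Theory Num.Theory.
Import numFieldNormedType.Exports.
Local Open Scope classical_set_scope.
Local Open Scope ring_scope.

(** * Inner products and bounded operators *)

Section inner_product.
Context {R : realType} {H : hilbertType R}.
Implicit Types (x y z u v e : H) (a b c : R) (s t : seq H).

(** The powers inside the Schatten norm are chosen through some eigenbasis, which need not be
    [onsystem]; the norm is opaque until traces are known to be independent of the basis. After that
    only the pairing description is used. Bases carry no enumeration, so infinite sums are
    approximated along finite duplicate-free lists, and limits become inequalities with an error
    [K * eps]. The equation [rho^* = R0 w] follows from [R0 rho^* = R1^* = R0 R0 w] by injectivity
    of [R0]. The error bound is deterministic: it holds at each outcome where both squared
    estimation errors are at most a constant times [gamma]. Probability enters only through a union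
    bound for the outer measure. The operator [S] is coercive because [<A A x, x> = |A x|^2] for
    self-adjoint [A], whatever the signs of its eigenvalues. Finally [gamma / alpha + alpha + gamma]
    is at most a constant times [gamma / alpha^3 + alpha] as soon as [gamma <= 1]. *)

Lemma innerDl x y z : inner (x + y) z = inner x z + inner y z.
Proof. by have := inner_linearl z 1 x y; rewrite /= scale1r mul1r. Qed.

Lemma inner0l z : inner (0 : H) z = 0.
Proof. by apply: (addrI (inner (0 : H) z)); rewrite -innerDl !addr0. Qed.

Lemma innerZl a x z : inner (a *: x) z = a * inner x z.
Proof. by have := inner_linearl z a x 0; rewrite /= !addr0 inner0l addr0. Qed.

Lemma innerNl x z : inner (- x) z = - inner x z.
Proof. by rewrite -scaleN1r innerZl mulN1r. Qed.

Lemma innerBl x y z : inner (x - y) z = inner x z - inner y z.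
Proof. by rewrite innerDl innerNl. Qed.

Lemma innerDr x y z : inner z (x + y) = inner z x + inner z y.
Proof. by rewrite !(innerC z) innerDl. Qed.

Lemma inner0r z : inner z (0 : H) = 0.
Proof. by rewrite innerC inner0l. Qed.

Lemma innerZr a x z : inner z (a *: x) = a * inner z x.
Proof. by rewrite !(innerC z) innerZl. Qed.

Lemma innerNr x z : inner z (- x) = - inner z x.
Proof. by rewrite !(innerC z) innerNl. Qed.

Lemma innerBr x y z : inner z (x - y) = inner z x - inner z y.
Proof. by rewrite innerDr innerNr. Qed.

Lemma inner_suml (I : Type) (r : seq I) (F : I -> H) z :
  inner (\sum_(i <- r) F i) z = \sum_(i <- r) inner (F i) z.
Proof.
elim: r => [|i r IH]; first by rewrite !big_nil inner0l.
by rewrite !big_cons innerDl IH.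
Qed.

Lemma inner_sumr (I : Type) (r : seq I) (F : I -> H) z :
  inner z (\sum_(i <- r) F i) = \sum_(i <- r) inner z (F i).
Proof. by rewrite innerC inner_suml; apply: eq_bigr => i _; rewrite innerC. Qed.

Lemma inner_eq0 x : (forall y, inner x y = 0) -> x = 0.
Proof.
by move=> /(_ x)/eqP; rewrite inner_norm sqrf_eq0 normr_eq0 => /eqP.
Qed.

Lemma inner_inj x y : (forall z, inner x z = inner y z) -> x = y.
Proof.
move=> h; apply/eqP; rewrite -subr_eq0; apply/eqP; apply: inner_eq0 => z.
by rewrite innerBl h subrr.
Qed.

Lemma sqr_normD x y : `|x + y| ^+ 2 = `|x| ^+ 2 + 2 * inner x y + `|y| ^+ 2.
Proof.
by rewrite -!inner_norm innerDl !innerDr (innerC y x); ring.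
Qed.

Lemma sqr_normB x y : `|x - y| ^+ 2 = `|x| ^+ 2 - 2 * inner x y + `|y| ^+ 2.
Proof. by rewrite sqr_normD innerNr normrN; ring. Qed.

(** The squared norm of [|y|^2 x - <x, y> y] is [|y|^2] times the difference of the squared
    sides. *)
Lemma cauchy_schwarz x y : `|inner x y| <= `|x| * `|y|.
Proof.
have [->|y0] := eqVneq y 0; first by rewrite inner0r normr0 mulr_ge0.
have ny : 0 < `|y| by rewrite normr_gt0.
rewrite -(@ler_pXn2r _ 2) ?nnegrE ?mulr_ge0//.
have := sqr_ge0 `| (`|y| ^+ 2) *: x - inner x y *: y |.
rewrite sqr_normB innerZl innerZr !normrZ !exprMn ger0_norm ?sqr_ge0//.
have -> : `|inner x y| ^+ 2 = inner x y ^+ 2 by rewrite real_normK ?num_real.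
rewrite [X in _ <= X](_ : _ = `|y| ^+ 2 * ((`|x| * `|y|) ^+ 2 - inner x y ^+
  2)).
  by rewrite pmulr_rge0 ?exprn_gt0// subr_ge0 exprMn.
ring.
Qed.

Lemma inner_le x y : inner x y <= `|x| * `|y|.
Proof. exact: le_trans (ler_norm _) (cauchy_schwarz x y). Qed.

Lemma norm_le_inner x c : 0 <= c -> (forall y, inner x y <= c * `|y|) ->
  `|x| <= c.
Proof.
move=> c0 /(_ x); rewrite inner_norm expr2.
have [->|x0] := eqVneq x 0; first by rewrite normr0.
by rewrite ler_pM2r ?normr_gt0.
Qed.

Lemma linear_bounded_op (A : H -> H) (C : R) : linear A ->
  (forall x, `|A x| <= C * `|x|) -> bounded_op A.
Proof.
move=> lA bA; split => // x; apply/cvgrPdist_lt => e e0.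
have C1 : 0 < `|C| + 1 by rewrite ltr_wpDl.
near=> y; have -> : A x - A y = A (x - y).
  by rewrite -[x - y]addrC -(scaleN1r y) lA scaleN1r addrC.
apply: le_lt_trans (bA _) _; apply: (@le_lt_trans _ _ ((`|C| + 1) * `|x - y|)).
  by rewrite ler_wpM2r// ler_wpDr// ler_norm.
rewrite mulrC -ltr_pdivlMr//; near: y.
by apply: (@cvgr_dist_lt _ _ _ _ _ id) => //; rewrite divr_gt0.
Unshelve. all: by end_near. Qed.

Section bounded.
Variable A : H -> H.
Hypothesis bA : bounded_op A.

Lemma bopD x y : A (x + y) = A x + A y.
Proof. by have := bA.1 1 x y; rewrite !scale1r. Qed.

Lemma bop0 : A 0 = 0.
Proof. by apply: (addrI (A 0)); rewrite -bopD !addr0. Qed.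

Lemma bopZ a x : A (a *: x) = a *: A x.
Proof. by have := bA.1 a x 0; rewrite !addr0 bop0 addr0. Qed.

Lemma bopN x : A (- x) = - A x.
Proof. by rewrite -scaleN1r bopZ scaleN1r. Qed.

Lemma bopB x y : A (x - y) = A x - A y.
Proof. by rewrite bopD bopN. Qed.

Lemma bop_sum (I : Type) (r : seq I) (F : I -> H) :
  A (\sum_(i <- r) F i) = \sum_(i <- r) A (F i).
Proof.
elim: r => [|i r IH]; first by rewrite !big_nil bop0.
by rewrite !big_cons bopD IH.
Qed.

Lemma bop_bounded : exists2 C, 0 < C & forall x, `|A x| <= C * `|x|.
Proof.
have := bA.2 0; rewrite /continuous_at bop0 => /cvgrPdist_lt/(_ 1 ltr01).
move=> /nbhs_ballP[d /= d0 hd]; exists (2 / d); first by rewrite divr_gt0.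
move=> x; have [->|x0] := eqVneq x 0; first by rewrite bop0 !normr0 mulr0.
have nx : 0 < `|x| by rewrite normr_gt0.
(* [k *: x] has norm [d / 2], inside the ball on which [|A| < 1]. *)
pose k := d / 2 / `|x|; have k0 : 0 < k by rewrite !divr_gt0.
have := hd (k *: x); rewrite -ball_normE /= !sub0r !normrN.
rewrite bopZ // (normrZ k x) (normrZ k (A x)) gtr0_norm// {1}/k divfK ?gt_eqF//.
move=> /(_ _)/wrap[|h]; first by lra.
have : 1 / k = 2 / d * `|x| by rewrite /k; field; rewrite !gt_eqF.
by move=> <-; rewrite ler_pdivlMr// mulrC ltW.
Qed.

End bounded.

Lemma inner_continuousl z : continuous (inner^~ z : H -> R).
Proof.
move=> x; apply/cvgrPdist_lt => e e0; near=> y.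
rewrite -innerBl; apply: le_lt_trans (cauchy_schwarz _ _) _.
apply: (@le_lt_trans _ _ (`|x - y| * (`|z| + 1))).
  by rewrite ler_wpM2l// lerDl.
rewrite -ltr_pdivlMr ?ltr_wpDl//; near: y.
by apply: (@cvgr_dist_lt _ _ _ _ _ id) => //; rewrite divr_gt0// ltr_wpDl.
Unshelve. all: by end_near. Qed.

Lemma bop_comp (A B : H -> H) : bounded_op A -> bounded_op B ->
  bounded_op (A \o B).
Proof.
move=> bA bB; split=> [a x y|x]; first by rewrite /= (bopD bB) (bopZ bB) bA.1.
exact: continuous_comp (bB.2 x) (bA.2 _).
Qed.

Lemma bop_add (A B : H -> H) : bounded_op A -> bounded_op B ->
  bounded_op (A + B).
Proof.
move=> bA bB; split=> [a x y|x]; last by apply: continuousD;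
  [exact: bA.2|exact: bB.2].
by rewrite /GRing.add /= bA.1 bB.1 scalerDr addrACA.
Qed.

Lemma bop_scale (A : H -> H) a : bounded_op A -> bounded_op (a *: A).
Proof.
move=> bA; split=> [b x y|x]; last by apply: cvgZ; [exact: cvg_cst|exact: bA.2].
rewrite -[LHS]/(a *: A (b *: x + y)) -[RHS]/(b *: (a *: A x) + a *: A y).
by rewrite bA.1 scalerDr !scalerA mulrC.
Qed.

Lemma bop_opp (A : H -> H) : bounded_op A -> bounded_op (- A).
Proof. by move=> /(bop_scale (-1)); rewrite scaleN1r. Qed.

Lemma bop_sub (A B : H -> H) : bounded_op A -> bounded_op B ->
  bounded_op (A - B).
Proof. by move=> bA bB; apply: bop_add => //; apply: bop_opp. Qed.

Lemma bop_id : bounded_op (idfun : H -> H).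
Proof. by split=> // x; exact: cvg_id. Qed.

End inner_product.

(** * Orthonormal systems and the Riesz representation *)

Section orthonormal.
Context {R : realType} {H : hilbertType R}.
Implicit Types (x y z v e : H) (s t u : seq H) (c : H -> R) (E : set H).

Definition orthonormal E :=
  (forall e, E e -> `|e| = 1) /\
  (forall e f, E e -> E f -> e <> f -> inner e f = 0).

(** Finite subsets of [E]. [E] may have any cardinality, so sums over it are handled as nets over
    these lists, directed by inclusion. *)
Definition ulist E s := uniq s /\ forall e, e \in s -> E e.

Definition comb c s : H := \sum_(e <- s) c e *: e.

Lemma ulist_union E s t : ulist E s -> ulist E t ->
  exists u, [/\ ulist E u, {subset s <= u} & {subset t <= u}].
Proof.
move=> [_ Es] [_ Et]; exists (undup (s ++ t)); split.
- split; first exact: undup_uniq.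
  by move=> e; rewrite mem_undup mem_cat => /orP[/Es|/Et].
- by move=> e es; rewrite mem_undup mem_cat es.
- by move=> e es; rewrite mem_undup mem_cat es orbT.
Qed.

Lemma ulist1 E e : E e -> ulist E [:: e].
Proof. by move=> Ee; split => // f; rewrite inE => /eqP ->. Qed.

Section fixed.
Variable E : set H.
Hypothesis onE : orthonormal E.

Lemma inner_comb c s e : ulist E s -> e \in s -> inner (comb c s) e = c e.
Proof.
move=> [us Es] es; rewrite inner_suml (bigD1_seq e)//= innerZl inner_norm.
rewrite onE.1 ?expr1n ?mulr1; last exact: Es.
rewrite big_seq_cond big1 ?addr0// => f /andP[fs fe].
by rewrite innerZl onE.2 ?mulr0; [|exact: Es|exact: Es|exact/eqP].
Qed.

Lemma comb_norm c s : ulist E s -> `|comb c s| ^+ 2 = \sum_(e <- s) c e ^+ 2.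
Proof.
move=> us; rewrite -inner_norm {2}/comb inner_sumr big_seq [RHS]big_seq.
by apply: eq_bigr => e es; rewrite innerZr inner_comb.
Qed.

Lemma comb_sub c s t : ulist E s -> ulist E t -> {subset s <= t} ->
  `|comb c t - comb c s| ^+ 2 = \sum_(e <- t) c e ^+ 2 - \sum_(e <- s) c e ^+ 2.
Proof.
move=> us ut st; rewrite sqr_normB !comb_norm//.
have -> : inner (comb c t) (comb c s) = \sum_(e <- s) c e ^+ 2.
  rewrite {2}/comb inner_sumr big_seq [RHS]big_seq.
  by apply: eq_bigr => e es; rewrite innerZr inner_comb// st.
ring.
Qed.

Lemma proj_norm x s : ulist E s ->
  `|x - comb (inner x) s| ^+ 2 = `|x| ^+ 2 - \sum_(e <- s) inner x e ^+ 2.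
Proof.
move=> us; rewrite sqr_normB comb_norm//.
have -> : inner x (comb (inner x) s) = \sum_(e <- s) inner x e ^+ 2.
  by rewrite inner_sumr; apply: eq_bigr => e _; rewrite innerZr.
ring.
Qed.

Lemma bessel x s : ulist E s -> \sum_(e <- s) inner x e ^+ 2 <= `|x| ^+ 2.
Proof. by move=> us; rewrite -subr_ge0 -proj_norm// sqr_ge0. Qed.

(** Lists [s n] are chosen whose sums of squares come within [dl n ^+ 2] of the supremum. By
    Pythagoras any enlargement moves the combination by at most [dl n]. The lists need not be
    nested: two of them are compared through their union, which gives a Cauchy sequence. *)
Lemma riesz_fischer c B :
  (forall s, ulist E s -> \sum_(e <- s) c e ^+ 2 <= B) ->
  exists y, (forall e, E e -> inner y e = c e) /\
    forall eps, 0 < eps -> exists2 s, ulist E s & `|y - comb c s| < eps.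
Proof.
move=> hB.
pose A := [set \sum_(e <- s) c e ^+ 2 | s in ulist E].
have supA : has_sup A.
  split; first by exists (\sum_(e <- [::]) c e ^+ 2), [::].
  by exists B => _ [s us <-]; exact: hB.
pose dl (n : nat) : R := n.+1%:R^-1.
have dl0 n : 0 < dl n by rewrite invr_gt0.
have /choice[s hs] n : exists s, ulist E s /\
    sup A - dl n ^+ 2 < \sum_(e <- s) c e ^+ 2.
  have [_ [s us <-] h] := sup_adherent (exprn_gt0 2 (dl0 n)) supA.
  by exists s.
have close n t : ulist E t -> {subset s n <= t} ->
    `|comb c t - comb c (s n)| <= dl n.
  move=> ut st; have [us hn] := hs n.
  rewrite -(@ler_pXn2r _ 2) ?nnegrE// ?ltW// comb_sub//.
  have : \sum_(e <- t) c e ^+ 2 <= sup A.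
    by apply: ub_le_sup; [case: supA|exists t].
  by move: hn; lra.
have close2 n m : `|comb c (s n) - comb c (s m)| <= dl n + dl m.
  have [u [uu su tu]] := ulist_union (hs n).1 (hs m).1.
  apply: le_trans (ler_distD (comb c u) _ _) _.
  by apply: lerD; [rewrite distrC|]; exact: close.
have dlcvg eps : 0 < eps -> \forall n \near \oo, dl n < eps.
  move=> e0; have := @cvg_harmonic R.
  move=> /cvgrPdist_lt/(_ _ e0); apply: filterS => n.
  by rewrite sub0r normrN ger0_norm// ltW// dl0.
have /cauchy_cvgP : cauchy ((fun n => comb c (s n)) @ \oo).
  apply: cauchy_exP => eps e0.
  have /dlcvg[N _ hN] : 0 < eps / 2 by rewrite divr_gt0.
  exists (comb c (s N)); exists N => // n /= Nn.
  rewrite -ball_normE /=; apply: le_lt_trans (close2 _ _) _.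
  by rewrite [eps]splitr ltrD// hN /=.
move=> /cvg_ex[y yl]; exists y.
have ycl eps : 0 < eps ->
    exists n, `|y - comb c (s n)| < eps /\ dl n < eps.
  move=> e0; have /cvgrPdist_lt/(_ _ e0) h := yl.
  have [N _ hN] := filterI h (dlcvg _ e0).
  by exists N; apply: hN => /=.
split=> [e Ee|eps /ycl[n [yn _]]]; last by exists (s n) => //; case: (hs n).
apply/eqP; rewrite -subr_eq0 -normr_le0; apply/ler_addgt0Pl => eps e0.
have /ycl[n [yn dn]] : 0 < eps / 2 by rewrite divr_gt0.
(* Joining [e] to [s n] makes the coefficient at [e] exactly [c e], at a cost of at most [dl n]. *)
have [u [uu su eu]] := ulist_union (hs n).1 (ulist1 Ee).
rewrite -(inner_comb c uu (eu e (mem_head _ _))) -innerBl.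
apply: le_trans (cauchy_schwarz _ _) _; rewrite (onE.1 _ Ee) mulr1 addr0.
apply: le_trans (ler_distD (comb c (s n)) _ _) _.
rewrite [eps]splitr lerD ?(ltW yn)// distrC (le_trans (close _ _ uu su))//.
exact: ltW.
Qed.

End fixed.

Lemma complete_on E : complete_orthonormal E -> orthonormal E.
Proof. by case. Qed.

Section complete.
Variable E : set H.
Hypothesis coE : complete_orthonormal E.
Let onE := complete_on coE.

Lemma complete_inj x y : (forall e, E e -> inner x e = inner y e) -> x = y.
Proof.
move=> h; apply/eqP; rewrite -subr_eq0; apply/eqP; case: coE => _ _; apply.
by move=> e Ee; rewrite innerBl h// subrr.
Qed.

(** Riesz-Fischer for the coefficients of [x], square-summable by Bessel; completeness identifies
    the limit with [x]. The bound holds for all larger lists, since enlarging a list only improves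
    the projection, so that finitely many vectors can share one list. *)
Lemma expansion x eps : 0 < eps -> exists2 s, ulist E s &
  forall t, ulist E t -> {subset s <= t} -> `|x - comb (inner x) t| < eps.
Proof.
move=> e0; have [y [ye yc]] := riesz_fischer onE (bessel onE x).
have xy : y = x by apply: complete_inj => e Ee; rewrite ye.
have [s us hs] := yc _ e0; exists s => // t ut st.
apply: le_lt_trans hs; rewrite xy -(@ler_pXn2r _ 2) ?nnegrE//.
rewrite !(proj_norm onE)// lerD2l lerN2 -subr_ge0.
by rewrite -(comb_sub onE)// sqr_ge0.
Qed.

Lemma expansions (l : seq H) eps : 0 < eps -> exists2 s, ulist E s &
  forall x t, x \in l -> ulist E t -> {subset s <= t} ->
    `|x - comb (inner x) t| < eps.
Proof.
move=> e0; elim: l => [|x l [s us hs]]; first by exists [::].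
have [s' us' hs'] := expansion x e0.
have [u [uu su su']] := ulist_union us us'.
exists u => // y t; rewrite inE => /orP[/eqP ->|yl] ut ut'.
  by apply: hs' => // e /su'/ut'.
by apply: hs => // e /su/ut'.
Qed.

(** The representative has coordinates [phi e]. They are square-summable: the sum of squares [S]
    over a finite list is the value of [phi] at a vector of norm [sqrt S], so [S^2 <= C^2 S]. *)
Lemma riesz_of_basis (phi : H -> R) (C : R) : scalar phi ->
  (forall x, `|phi x| <= C * `|x|) -> exists z, forall x, phi x = inner x z.
Proof.
move=> lphi bphi.
have pD x y : phi (x + y) = phi x + phi y.
  by have := lphi 1 x y; rewrite /= scale1r mul1r.
have p0 : phi 0 = 0 by apply: (addrI (phi 0)); rewrite -pD !addr0.
have pZ a x : phi (a *: x) = a * phi x.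
  by have := lphi a x 0; rewrite /= !addr0 p0 addr0.
have pcomb c s : phi (comb c s) = \sum_(e <- s) c e * phi e.
  rewrite /comb; elim: s => [|e s IH]; first by rewrite !big_nil p0.
  by rewrite !big_cons pD pZ IH.
have [|z [ze _]] := @riesz_fischer E onE phi (C ^+ 2).
  move=> s us; set S := (X in X <= _).
  have S0 : 0 <= S by apply: sumr_ge0 => e _; rewrite sqr_ge0.
  have pS : phi (comb phi s) = S by rewrite pcomb; apply: eq_bigr => e _.
  have : S ^+ 2 <= C ^+ 2 * S.
    rewrite -[X in _ <= _ * X](comb_norm onE phi us) -exprMn -{1}pS.
    by rewrite -(real_normK (num_real (phi _))) ler_pXn2r ?nnegrE// (le_trans _
      (bphi _)).
  have [->|Sn] := eqVneq S 0; first by rewrite sqr_ge0.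
  by rewrite expr2 ler_pM2r// lt_neqAle eq_sym Sn.
exists z => x; apply/eqP; rewrite -subr_eq0 -normr_le0.
apply/ler_addgt0Pl => eps e0; rewrite addr0.
(* A Lipschitz constant of [phi - <., z>], increased by [1] to be positive. *)
pose K := `|C| + `|z| + 1.
have K0 : 0 < K by rewrite /K ltr_wpDl// addr_ge0.
have [s us /(_ s us (fun _ => id)) hs] := expansion x (divr_gt0 e0 K0).
have -> : phi x - inner x z =
    phi (x - comb (inner x) s) - inner (x - comb (inner x) s) z.
  have e1 : phi (comb (inner x) s) = inner (comb (inner x) s) z.
    rewrite pcomb inner_suml big_seq [RHS]big_seq; apply: eq_bigr => e es.
    by rewrite innerZl (innerC e) ze//; apply: us.2.
  have e2 : phi x = phi (x - comb (inner x) s) + phi (comb (inner x) s).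
    by rewrite -pD subrK.
  rewrite innerBl e2 e1; ring.
apply: le_trans (ler_normB _ _) _.
apply: (@le_trans _ _ (K * `|x - comb (inner x) s|)); last first.
  by rewrite mulrC -ler_pdivlMr// ltW.
rewrite /K -addrA !mulrDl lerD//.
  by apply: le_trans (bphi _) _; rewrite ler_wpM2r// ler_norm.
by apply: le_trans (cauchy_schwarz _ _) _; rewrite mulrC mul1r lerDl.
Qed.

End complete.

(** Zorn's lemma on orthonormal subsets of [Q]. With [Q] everything it yields a complete system;
    with [Q] the eigenvectors of [A^* A] it starts the spectral theorem. *)
Lemma extend_orthonormal (Q : set H) : exists E, [/\ orthonormal E, E `<=` Q &
  forall x, Q x -> `|x| = 1 -> (forall e, E e -> inner x e = 0) -> False].
Proof.
pose P (E : set H) := orthonormal E /\ E `<=` Q.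
have [|A [[onA AQ] maxA]] := @Zorn_bigcup _ P.
  move=> F FP tF; split; last by move=> x [X FX Xx]; apply: (FP X FX).2.
  split=> [e [X FX Xe]|e f [X FX Xe] [Y FY Yf]]; first exact: (FP X FX).1.1.
  have [XY|YX] := tF X Y FX FY.
    by apply: (FP Y FY).1.2 => //; apply: XY.
  by apply: (FP X FX).1.2 => //; apply: YX.
exists A; split => // x Qx nx xA.
have /(maxA _) : A `<` A `|` [set x].
  split; first exact: subsetUl.
  move=> /(_ x (or_intror erefl))/xA/eqP.
  by rewrite inner_norm nx expr1n oner_eq0.
apply; split; last by move=> y [/AQ|->].
split=> [e [|->//]|e f [Ae|->] [Af|->] ef] //; first exact: onA.1.
- exact: onA.2.
- by rewrite innerC xA.
- by rewrite xA.
Qed.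

Lemma complete_orthonormal_exists : exists E : set H, complete_orthonormal E.
Proof.
have [E [[n1 o1] _ mE]] := extend_orthonormal setT; exists E; split=> // x hx.
apply/eqP/negPn/negP => x0.
have nx : `|x| != 0 by rewrite normr_eq0.
apply: (mE (`|x|^-1 *: x)) => //.
  by rewrite normrZ normfV normr_id mulVf.
by move=> e /hx; rewrite innerZl => ->; rewrite mulr0.
Qed.

Lemma onsystemP : complete_orthonormal (onsystem H).
Proof. exact: getPex complete_orthonormal_exists. Qed.

Lemma riesz (phi : H -> R) (C : R) : scalar phi ->
  (forall x, `|phi x| <= C * `|x|) -> exists z, forall x, phi x = inner x z.
Proof. exact: riesz_of_basis onsystemP _ _. Qed.

End orthonormal.

(** * Adjoints and compact operators *)

Section operators.
Context {R : realType} {H : hilbertType R}.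
Implicit Types (x y z v e : H) (s t : seq H) (A B : H -> H) (E : set H).

Lemma adjointP A x y : bounded_op A -> inner (A x) y = inner x (adjoint A y).
Proof.
move=> bA; have [C C0 hC] := bop_bounded bA.
suff /getPex/(_ x) : exists z, forall x, inner (A x) y = inner x z by [].
apply: (@riesz R H _ (C * `|y|)) => [a u v|u /=].
  by rewrite (bopD bA) (bopZ bA) innerDl innerZl.
by apply: le_trans (cauchy_schwarz _ _) _; rewrite mulrAC ler_wpM2r.
Qed.

Lemma adjointPr A x y : bounded_op A -> inner x (A y) = inner (adjoint A x) y.
Proof. by move=> bA; rewrite innerC adjointP// innerC. Qed.

Lemma adjoint_unique A B :
  (forall x y, inner (A x) y = inner x (B y)) -> adjoint A = B.
Proof.
move=> h; apply/funext => y.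
have := @getPex _ [set z | forall x, inner (A x) y = inner x z].
move=> /(_ _)/wrap[|g]; first by exists (B y) => x.
by apply: inner_inj => z; rewrite innerC -g h innerC.
Qed.

Lemma bop_adjoint A : bounded_op A -> bounded_op (adjoint A).
Proof.
move=> bA; have [C C0 hC] := bop_bounded bA.
apply: (@linear_bounded_op R H _ C) => [a x y|x].
  apply: inner_inj => z.
  by rewrite innerDl innerZl -!(adjointPr _ _ bA) innerDl innerZl.
apply: norm_le_inner => [|y]; first by rewrite mulr_ge0// ltW.
rewrite -(adjointPr _ _ bA); apply: le_trans (inner_le _ _) _.
by rewrite mulrC mulrAC ler_wpM2r.
Qed.

Lemma adjointK A : bounded_op A -> adjoint (adjoint A) = A.
Proof. by move=> bA; apply: adjoint_unique => x y; rewrite adjointPr. Qed.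

Lemma adjoint_comp A B : bounded_op A -> bounded_op B ->
  adjoint (A \o B) = adjoint B \o adjoint A.
Proof. by move=> bA bB; apply: adjoint_unique => x y; rewrite /= !adjointP. Qed.

Lemma adjoint_sub A B : bounded_op A -> bounded_op B ->
  adjoint (A - B) = adjoint A - adjoint B.
Proof.
move=> bA bB; apply: adjoint_unique => x y.
rewrite -[(A - B) x]/(A x - B x) -[(adjoint A - _) y]/(adjoint A y - adjoint B
  y).
by rewrite innerBl innerBr !adjointP.
Qed.

Lemma adjoint_self A : selfadjoint A -> adjoint A = A.
Proof. exact: adjoint_unique. Qed.

Lemma adjoint_bound A C : bounded_op A -> 0 <= C ->
  (forall x, `|A x| <= C * `|x|) -> forall x, `|adjoint A x| <= C * `|x|.
Proof.
move=> bA C0 hC x; apply: norm_le_inner => [|y]; first by rewrite mulr_ge0.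
rewrite -(adjointPr _ _ bA); apply: le_trans (inner_le _ _) _.
by rewrite mulrC mulrAC ler_wpM2r.
Qed.

(* Total boundedness of the image of the unit ball, by finite colourings of
   the ball instead of nets: colourings pull back along operators. *)
Definition finitely_colorable A := forall eps, 0 < eps ->
  exists (I : finType) (c : H -> I), forall x y, `|x| <= 1 -> `|y| <= 1 ->
    c x = c y -> `|A x - A y| < eps.

Lemma compact_colorable A : compact_op A -> finitely_colorable A.
Proof.
move=> [bA +] eps e0; rewrite compact_cover => cK.
have e2 : 0 < eps / 2 by rewrite divr_gt0.
set K := closure _ in cK.
have AK x : `|x| <= 1 -> K (A x) by move=> x1; apply: subset_closure; exists x.
have [||D' _ hD'] := cK H K (fun k => ball k (eps / 2)).
- by move=> i _; exact: ball_open.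
- by move=> k Kk; exists k => //; exact: ballxx.
(* The colour is the index of the first ball containing [A x]. The extra index [size], meaning no
   ball, can occur only off the unit ball. *)
pose col (x : H) := find (fun k => `[< ball k (eps / 2) (A x) >])
  (finmap.enum_fset D').
exists 'I_(size (finmap.enum_fset D')).+1, (fun x => inord (col x)) => x y x1
  y1.
have hl z : (col z < (size (finmap.enum_fset D')).+1)%N by rewrite ltnS
  find_size.
move=> /(congr1 val); rewrite /= !inordK// => cxy.
have hb z : `|z| <= 1 -> ball (nth 0 (finmap.enum_fset D') (col z)) (eps / 2)
  (A z).
  move=> z1; have [k kD kz] := hD' _ (AK _ z1).
  have hz : has (fun k => `[< ball k (eps / 2) (A z) >]) (finmap.enum_fset D').
    by apply/hasP; exists k => //; apply/asboolP.
  by have /asboolP := nth_find 0 hz.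
have := hb _ x1; have := hb _ y1; rewrite cxy -ball_normE /= => hy hx.
rewrite [eps]splitr; apply: le_lt_trans (ler_distD _ _ _) _.
by apply: ltrD hy; rewrite distrC.
Qed.

Lemma notin_closure (B : set H) y : ~ closure B y -> nbhs y (~` B).
Proof.
move=> h; apply: contrapT => hn; apply: h => U nU.
apply: contrapT => hU; apply: hn; apply: filterS nU => z Uz Bz.
by apply: hU; exists z.
Qed.

(** An ultrafilter on [K] contains the closure of the image of one colour class, there being
    finitely many. Such a set is small, so the ultrafilter is Cauchy and converges by
    completeness. *)
Lemma colorable_compact A : bounded_op A -> finitely_colorable A ->
  compact_op A.
Proof.
move=> bA fA; split => //; set K := closure _.
rewrite compact_ultra => F FU FK.
have PF : ProperFilter F by exact: ultra_proper.
suff /cauchy_cvgP/cvg_ex[l Fl] : cauchy F.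
  exists l; split => //; apply: (closed_closure); apply: (@closed_closure _ _).
  move=> U /Fl FU'; have [z []] := filter_ex (filterI FK FU').
  by move=> ? ?; exists z; split => //; exact: subset_closure.
apply: cauchy_exP => eps e0.
have e3 : 0 < eps / 3 by rewrite divr_gt0.
have [I [c hc]] := fA _ e3.
pose S i := closure (A @` [set x : H | `|x| <= 1 /\ c x = i]).
have [i Fi] : exists i, F (S i).
  apply: contrapT => /forallNP h.
  have FC i : F (~` S i) by case: (in_ultra_setVsetC (S i) FU) => // /h.
  have [y [Ky hy]] := filter_ex (filterI FK (filter_forall _ FC)).
  have : nbhs y (fun z => forall i, (~` (A @` [set x | `|x| <= 1 /\ c x = i]))
    z).
    by apply: filter_forall => i; apply: notin_closure; exact: hy.
  by move=> /Ky[_ [[x x1 <-]]] /(_ (c x)); apply; exists x.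
have [y0 Sy0] := filter_ex Fi.
have near_img y : S i y -> exists x, [/\ `|x| <= 1, c x = i & `|y - A x| < eps
  / 3].
  move=> /(_ _ (nbhsx_ballx y _ e3))[_ [[x [x1 cx] <-]]].
  by rewrite -ball_normE /= => h; exists x.
exists y0; apply: filterS Fi => y /near_img[x [x1 cx yx]].
have [x0 [x01 cx0 yx0]] := near_img _ Sy0.
rewrite -ball_normE /=; have := hc x0 x x01 x1; rewrite cx cx0 => /(_ erefl) h.
have := ler_distD (A x0) y0 y; have := ler_distD (A x) (A x0) y.
by move: yx; rewrite (distrC y (A x)); lra.
Qed.

Lemma compact_op_add A B : compact_op A -> compact_op B -> compact_op (A + B).
Proof.
move=> cA cB; apply: colorable_compact; first by apply: bop_add;
  [case: cA|case: cB].
move=> eps e0; have e2 : 0 < eps / 2 by rewrite divr_gt0.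
have [I [c hc]] := compact_colorable cA e2.
have [J [d hd]] := compact_colorable cB e2.
exists (I * J)%type, (fun x => (c x, d x)) => x y x1 y1 [cxy dxy].
rewrite -[(A + B) x]/(A x + B x) -[(A + B) y]/(A y + B y) opprD addrACA.
by rewrite [eps]splitr (le_lt_trans (ler_normD _ _))// ltrD ?hc ?hd.
Qed.

Lemma compact_op_compl A B : bounded_op B -> compact_op A ->
  compact_op (B \o A).
Proof.
move=> bB cA; apply: colorable_compact; first by apply: bop_comp; [|case: cA].
have [C C0 hC] := bop_bounded bB.
move=> eps e0; have [I [c hc]] := compact_colorable cA (divr_gt0 e0 C0).
exists I, c => x y x1 y1 cxy; rewrite /= -(bopB bB).
by apply: le_lt_trans (hC _) _; rewrite mulrC -ltr_pdivlMr// hc.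
Qed.

Lemma compact_op_compr A B : compact_op A -> bounded_op B ->
  compact_op (A \o B).
Proof.
move=> cA bB; apply: colorable_compact; first by apply: bop_comp; [case: cA|].
have [C C0 hC] := bop_bounded bB; have bA := cA.1.
move=> eps e0; have [I [c hc]] := compact_colorable cA (divr_gt0 e0 C0).
have Cx x : `|x| <= 1 -> `|C^-1 *: B x| <= 1.
  move=> x1; rewrite normrZ gtr0_norm ?invr_gt0// mulrC ler_pdivrMr// mul1r.
  by apply: le_trans (hC _) _; rewrite ler_piMr// ltW.
exists I, (fun x => c (C^-1 *: B x)) => x y x1 y1 cxy /=.
have := hc _ _ (Cx x x1) (Cx y y1) cxy.
rewrite !(bopZ bA) -scalerBr normrZ gtr0_norm ?invr_gt0// mulrC ltr_pM2r//.
by rewrite invr_gt0.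
Qed.

(* Schauder: [|A* x - A* y|^2 <= 2 |A A* x - A A* y|] on the unit ball. *)
Lemma compact_op_adjoint A : compact_op A -> compact_op (adjoint A).
Proof.
move=> cA; have bA := cA.1; have bA' := bop_adjoint bA.
apply: colorable_compact => // eps e0.
have e2 : 0 < eps ^+ 2 / 2 by rewrite divr_gt0// exprn_gt0.
have [I [c hc]] := compact_colorable (compact_op_compr cA bA') e2.
exists I, c => x y x1 y1 /(hc _ _ x1 y1) /= h.
rewrite -(@ltr_pXn2r _ 2) ?nnegrE ?(ltW e0)// -(bopB bA') -inner_norm
  -adjointPr//.
apply: le_lt_trans (inner_le _ _) _; rewrite (bopB bA') (bopB bA).
apply: (@le_lt_trans _ _ (2 * `|A (adjoint A x) - A (adjoint A y)|)).
  by rewrite ler_wpM2r// (le_trans (ler_normB _ _))//; lra.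
by rewrite mulrC -ltr_pdivlMr.
Qed.

End operators.

(** * The spectral theorem *)

Section spectral.
Context {R : realType} {H : hilbertType R}.
Implicit Types (x y z v e : H) (s t : seq H) (A B : H -> H) (E : set H).

(** The form in which limits are taken below: an error linear in [eps], with [K] of any sign. *)
Lemma le0_of_le_eps (a K : R) : (forall eps, 0 < eps -> a <= K * eps) -> a <= 0.
Proof.
move=> h; rewrite leNgt; apply/negP => a0.
have K1 : 0 < `|K| + 1 by rewrite ltr_wpDl.
have /h : 0 < a / 2 / (`|K| + 1) by rewrite !divr_gt0.
have : K * (a / 2 / (`|K| + 1)) <= a / 2.
  rewrite mulrA ler_pdivrMr// mulrC ler_wpM2l//;
    first by rewrite ltW// divr_gt0.
  by rewrite (le_trans (ler_norm _))// lerDl.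
lra.
Qed.

Lemma adjoint_comp_norm A x : bounded_op A ->
  inner (adjoint A (A x)) x = `|A x| ^+ 2.
Proof. by move=> bA; rewrite -adjointPr// inner_norm. Qed.

Section maximal_vector.
Variables (A : H -> H) (V : set H).
Hypotheses (cA : compact_op A).
Hypotheses (V_add : forall a x y, V x -> V y -> V (a *: x + y)).
Hypotheses (V_closed : forall y, (forall eps, 0 < eps ->
  exists2 x, V x & `|y - x| < eps) -> V y).
Hypotheses (V_inv : forall x, V x -> V (adjoint A (A x))).

Let bA := cA.1.
Let bA' := bop_adjoint bA.
Let T x := adjoint A (A x).

Let bT : bounded_op T. Proof. exact: bop_comp. Qed.

(** Let [m] be the supremum of [|A x|^2] over the unit ball of [V]. Along a maximizing sequence
    [w n], the vectors [A (w n)] have a cluster point [y] by compactness, and [z = A^* y] is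
    approached by [T (w n)]. Near-maximizers are near-eigenvectors, so [T z = m z], and [|z| >= m]
    makes [z] nonzero when [m > 0]. If [m = 0], then [A] vanishes on [V] and any unit vector
    serves. *)
Lemma exists_max_eigenvector x0 : V x0 -> x0 != 0 ->
  exists z, [/\ V z, `|z| = 1 & adjoint A (A z) = (`|A z| ^+ 2) *: z].
Proof.
move=> Vx0 x00.
have VZ a x : V x -> V (a *: x).
  move=> Vx; have V0 : V 0 by have := V_add (-1) Vx Vx; rewrite scaleN1r addNr.
  by rewrite -[_ *: _]addr0; apply: V_add.
have norm1 x : x != 0 -> `| `|x|^-1 *: x | = 1.
  by move=> xn; rewrite normrZ normfV normr_id mulVf// normr_eq0.
pose S := [set `|A x| ^+ 2 | x in [set x | V x /\ `|x| <= 1]].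
have [C C0 hC] := bop_bounded bA.
have [C' C'0 hC'] := bop_bounded bA'.
have supS : has_sup S.
  split; first by exists (`|A (`|x0|^-1 *: x0)| ^+ 2), (`|x0|^-1 *: x0) => //;
    split; [exact: VZ|rewrite norm1].
  exists (C ^+ 2) => _ [x [_ x1] <-]; rewrite ler_pXn2r ?nnegrE ?(ltW C0)//.
  by apply: le_trans (hC _) _; rewrite ler_piMr// ltW.
set m := sup S.
have mub x : V x -> `|x| <= 1 -> `|A x| ^+ 2 <= m.
  by move=> Vx x1; apply: ub_le_sup; [case: supS|exists x].
have mA x : V x -> `|A x| ^+ 2 <= m * `|x| ^+ 2.
  have [->|xn] := eqVneq x 0; first by rewrite (bop0 bA) !normr0 expr0n/= mulr0.
  move=> Vx; have := mub _ (VZ (`|x|^-1) x Vx);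
    rewrite norm1// => /(_ (lexx _)).
  rewrite (bopZ bA) normrZ exprMn normfV normr_id exprVn mulrC ler_pdivrMr//.
  by rewrite exprn_gt0// normr_gt0.
have m0 : 0 <= m.
  by apply: le_trans (sqr_ge0 _) (mub _ (VZ (`|x0|^-1) _ Vx0) _); rewrite norm1.
have TT x : `|A x| ^+ 2 = inner (T x) x by rewrite adjoint_comp_norm.
(* [|T x|^4 = <A x, A T x>^2], which is at most [m |x|^2] times [m |T x|^2] because [T x] stays in
   [V]. *)
have mT x : V x -> `|T x| <= m * `|x|.
  move=> Vx; have [->|Tn] := eqVneq (T x) 0; first by rewrite normr0 mulr_ge0.
  have Tp : 0 < `|T x| ^+ 2 by rewrite exprn_gt0// normr_gt0.
  rewrite -(@ler_pXn2r _ 2) ?nnegrE ?mulr_ge0// -(ler_pM2r Tp).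
  have -> : `|T x| ^+ 2 * `|T x| ^+ 2 = inner (A x) (A (T x)) ^+ 2.
    by rewrite adjointPr// inner_norm -expr2.
  have -> : (m * `|x|) ^+ 2 * `|T x| ^+ 2 =
      (m * `|x| ^+ 2) * (m * `|T x| ^+ 2) by ring.
  apply: (@le_trans _ _ (`|A x| ^+ 2 * `|A (T x)| ^+ 2)).
    rewrite -exprMn -(real_normK (num_real (inner _ _))).
    by rewrite ler_pXn2r ?nnegrE ?mulr_ge0// cauchy_schwarz.
  by rewrite ler_pM ?sqr_ge0// mA//; exact: V_inv.
have [m00|mn0] := eqVneq m 0.
  exists (`|x0|^-1 *: x0); split; [exact: VZ|exact: norm1|].
  have : `|A (`|x0|^-1 *: x0)| ^+ 2 <= 0 by rewrite -m00 mub ?norm1//;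
    exact: VZ.
  rewrite -/(T _) real_exprn_even_le0//= normr_eq0 => /eqP A0.
  by rewrite /T A0 (bop0 bA') normr0 expr0n scale0r.
have mp : 0 < m by rewrite lt_neqAle eq_sym mn0.
pose dl (n : nat) : R := n.+1%:R^-1.
have dl0 n : 0 < dl n by rewrite invr_gt0.
have /choice[w hw] n : exists x, [/\ V x, `|x| <= 1 & m - dl n < `|A x| ^+ 2].
  have [_ [x [Vx x1] <-] h] := sup_adherent (dl0 n) supS.
  by exists x.
have [y [_ cy]] : closure (A @` [set x | `|x| <= 1]) `&`
    cluster ((fun n => A (w n)) @ \oo) !=set0.
  apply: cA.2; exists 0%N => // n _ /=; apply: subset_closure.
  by exists (w n) => //; have [] := hw n.
have ycl eps : 0 < eps -> exists n, `|y - A (w n)| < eps /\ dl n < eps.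
  move=> e0; have := @cvg_harmonic R.
  move=> /cvgrPdist_lt/(_ _ e0)[N _ hN].
  have FN : ((fun n => A (w n)) @ \oo) [set A (w n) | n in [set n | (N <=
    n)%N]].
    by exists N => // n Nn; exists n.
  have [_ [[n /= Nn <-]]] := cy _ _ FN (nbhsx_ballx y _ e0).
  rewrite -ball_normE /= => yn; exists n; split=> //.
  by have := hN _ Nn; rewrite sub0r normrN ger0_norm// ltW// dl0.
pose z := adjoint A y.
have close eps : 0 < eps -> exists x, [/\ V x, `|x| <= 1,
    m - eps < `|A x| ^+ 2 & `|z - T x| <= C' * eps].
  move=> e0; have [n [yn dn]] := ycl _ e0; have [Vx x1 hx] := hw n.
  exists (w n); split=> //; first by apply: lt_trans hx; rewrite ltrD2l ltrN2.
  rewrite /z /T -(bopB bA'); apply: le_trans (hC' _) _.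
  by rewrite ler_pM2l// ltW.
have Vz : V z.
  apply: V_closed => eps e0;
    have [x [Vx _ _ zx]] := close _ (divr_gt0 (divr_gt0 e0 (ltr0Sn R 1)) C'0).
  exists (T x); first exact: V_inv.
  apply: le_lt_trans zx _; rewrite mulrC divfK ?gt_eqF//; lra.
have nz : m <= `|z|.
  rewrite -subr_le0; apply: (@le0_of_le_eps _ (1 + C')) => eps e0.
  have [x [Vx x1 hx zx]] := close _ e0.
  have : `|A x| ^+ 2 <= `|T x|.
    by rewrite TT; apply: le_trans (inner_le _ _) _; rewrite ler_piMr.
  have := ler_normD (z - T x) (- z); rewrite addrAC subrr sub0r !normrN.
  rewrite mulrDl; lra.
have Tz : T z = m *: z.
  apply/eqP; rewrite -subr_eq0 -normr_eq0 -sqrf_eq0 eq_le sqr_ge0 andbT.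
  have [D D0 hD] := bop_bounded (bop_sub bT (bop_scale m bop_id)).
  have {}hD v : `|T v - m *: v| <= D * `|v| by exact: hD.
  apply: (@le0_of_le_eps _ (2 * (D * C') ^+ 2 + 2 * (m ^+ 2 * (2 * m)))) => eps
    e0.
  (* Capped at [1] so that [del ^+ 2 <= del] and the final error is linear in [eps]. *)
  pose del := Num.min eps 1.
  have d0 : 0 < del by rewrite lt_min e0 ltr01.
  have de : del <= eps by rewrite ge_min lexx.
  have d1 : del <= 1 by rewrite ge_min lexx orbT.
  have [x [Vx x1 hx zx]] := close _ d0.
  (* Expand: [|T x|^2 - 2 m |A x|^2 + m^2 |x|^2 <= m^2 - 2 m (m - del) + m^2]. *)
  have h1 : `|T x - m *: x| ^+ 2 <= 2 * m * del.
    rewrite sqr_normB innerZr -TT normrZ gtr0_norm//.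
    have : `|T x| ^+ 2 <= m ^+ 2.
      rewrite ler_pXn2r ?nnegrE//; apply: le_trans (mT _ Vx) _.
      by rewrite ler_piMr.
    have : (m * `|x|) ^+ 2 <= m ^+ 2.
      by rewrite ler_pXn2r ?nnegrE ?mulr_ge0// ler_piMr.
    have : m * (m - del) <= m * `|A x| ^+ 2 by rewrite ler_pM2l// ltW.
    by rewrite !expr2; nra.
  have Vd : V (T x - m *: x).
    by rewrite addrC -scaleNr; apply: V_add => //; exact: V_inv.
  (* [T - m] commutes with [T], and [T] has norm at most [m] on [V]. *)
  have h2 : `|T (T x) - m *: T x| ^+ 2 <= m ^+ 2 * (2 * m * del).
    rewrite -(bopZ bT) -(bopB bT).
    apply: (@le_trans _ _ ((m * `|T x - m *: x|) ^+ 2)).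
      by rewrite ler_pXn2r ?nnegrE ?mulr_ge0//; exact: mT.
    by rewrite exprMn ler_wpM2l// sqr_ge0.
  pose g v := T v - m *: v.
  have gB : g z = g (z - T x) + g (T x).
    by rewrite /g (bopB bT) scalerBr opprB addrACA subrK addrAC subrr add0r.
  have h3 : `|g (z - T x)| ^+ 2 <= (D * C') ^+ 2 * del.
    apply: (@le_trans _ _ ((D * (C' * del)) ^+ 2)).
      rewrite ler_pXn2r ?nnegrE ?mulr_ge0// ?(ltW C'0) ?(ltW D0) ?(ltW d0)//.
      by apply: le_trans (hD _) _; rewrite ler_pM2l.
    rewrite mulrA exprMn ler_wpM2l ?sqr_ge0// expr2 ler_piMr// ltW//.
  rewrite -/(g z) gB.
  have : `|g (z - T x) + g (T x)| ^+ 2 <=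
      2 * `|g (z - T x)| ^+ 2 + 2 * `|g (T x)| ^+ 2.
    by have := sqr_ge0 (`|g (z - T x) - g (T x)|); rewrite sqr_normD sqr_normB;
      lra.
  move=> h4; apply: le_trans h4 _.
  have : (D * C') ^+ 2 * del <= (D * C') ^+ 2 * eps by rewrite ler_wpM2l
    ?sqr_ge0.
  have : m ^+ 2 * (2 * m * del) <= m ^+ 2 * (2 * m * eps).
    by rewrite !ler_wpM2l ?sqr_ge0// mulr_ge0.
  by move: h2 h3; rewrite /g; lra.
have zn : z != 0 by rewrite -normr_gt0 (lt_le_trans mp).
exists (`|z|^-1 *: z); split; [exact: VZ|exact: norm1|].
have e1 : T (`|z|^-1 *: z) = m *: (`|z|^-1 *: z).
  by rewrite (bopZ bT) Tz !scalerA mulrC.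
rewrite -/(T _) TT e1 innerZl inner_norm norm1// expr1n mulr1.
by [].
Qed.

End maximal_vector.

(** Take a maximal orthonormal set of eigenvectors of [A^* A]. Its orthogonal complement is closed
    and invariant; if it were nonzero, it would contain one more unit eigenvector. *)
Theorem spectral_theorem A : compact_op A -> exists E, complete_orthonormal E /\
  forall e, E e -> adjoint A (A e) = (`|A e| ^+ 2) *: e.
Proof.
move=> cA; have bA := cA.1; have bA' := bop_adjoint bA.
have [E [onE EQ mE]] := extend_orthonormal
  [set e | adjoint A (A e) = (`|A e| ^+ 2) *: e].
exists E; split; last exact: EQ.
split; [exact: onE.1|exact: onE.2|] => x hx.
apply/eqP/negPn/negP => xn0.
have [|||z [Vz z1 Qz]] := @exists_max_eigenvector A
    [set x | forall e, E e -> inner x e = 0] cA _ _ _ x hx xn0.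
- by move=> a u v hu hv e Ee; rewrite innerDl innerZl hu// hv// mulr0 addr0.
- move=> y hy e Ee; apply/eqP; rewrite -normr_le0.
  apply: (@le0_of_le_eps _ 1) => eps /hy[u hu yu].
  rewrite -[inner y e]subr0 -(hu _ Ee) -innerBl.
  apply: le_trans (cauchy_schwarz _ _) _.
  by rewrite (onE.1 _ Ee) mulr1 mul1r ltW.
- move=> u hu e Ee /=; rewrite innerC.
  by rewrite -adjointP// adjointPr// (EQ _ Ee) innerZl innerC hu// mulr0.
exact: mE Qz z1 Vz.
Qed.

(** The image of [x] is the vector with coordinates [mu e * <x, e>]. This supplies both the operator
    powers and the inverse of [A A + alpha]. *)
Lemma diagonal_op E (mu : H -> R) M : complete_orthonormal E -> 0 <= M ->
  (forall e, E e -> `|mu e| <= M) ->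
  exists B, bounded_op B /\ forall x e, E e -> inner (B x) e = mu e * inner x e.
Proof.
move=> coE M0 muM; have onE := complete_on coE.
have hb x s : ulist E s ->
    \sum_(e <- s) (mu e * inner x e) ^+ 2 <= (M * `|x|) ^+ 2.
  move=> us; rewrite exprMn.
  apply: (@le_trans _ _ (\sum_(e <- s) M ^+ 2 * inner x e ^+ 2)); last first.
    by rewrite -mulr_sumr ler_wpM2l ?sqr_ge0//; exact: (bessel onE).
  rewrite big_seq [leRHS]big_seq; apply: ler_sum => e /us.2 Ee.
  rewrite exprMn ler_wpM2r ?sqr_ge0// -(real_normK (num_real (mu e))).
  by rewrite ler_pXn2r ?nnegrE// muM.
have /choice[B hB] x := riesz_fischer onE (hb x).
exists B; split; last by move=> x e Ee; rewrite (hB x).1.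
apply: (@linear_bounded_op R H B M) => [a x y|x].
  apply: (complete_inj coE) => e Ee.
  by rewrite innerDl innerZl !(hB _).1// innerDl innerZl; ring.
rewrite -subr_le0; apply: (@le0_of_le_eps _ 1) => eps /(hB x).2[s us hs].
have : `|comb (fun e => mu e * inner x e) s| <= M * `|x|.
  rewrite -(@ler_pXn2r _ 2) ?nnegrE ?mulr_ge0// (comb_norm onE)//.
  exact: hb.
have := ler_normD (B x - comb (fun e => mu e * inner x e) s)
  (comb (fun e => mu e * inner x e) s).
by rewrite subrK; move: hs; lra.
Qed.

Lemma diagonal_op_eigen E (mu : H -> R) B : complete_orthonormal E ->
  (forall x e, E e -> inner (B x) e = mu e * inner x e) ->
  forall e, E e -> B e = mu e *: e.
Proof.
move=> coE hB e Ee; apply: (complete_inj coE) => f Ef.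
rewrite hB// innerZl; have [->//|ef] := eqVneq e f.
by case: coE => _ -> //; [rewrite !mulr0|apply/eqP].
Qed.

Lemma op_power_exists A (s : R) : compact_op A -> 0 <= s ->
  exists B, is_op_power (adjoint A \o A) s B.
Proof.
move=> cA s0; have [E [coE hE]] := spectral_theorem cA.
have [C C0 hC] := bop_bounded cA.1.
have [|e Ee|B [bB hB]] := @diagonal_op E (fun e => (`|A e| ^+ 2) `^ s)
    ((C ^+ 2) `^ s) coE.
- exact: powR_ge0.
- rewrite ger0_norm ?powR_ge0// ge0_ler_powR ?nnegrE ?sqr_ge0//.
  rewrite ler_pXn2r ?nnegrE ?(ltW C0)//; apply: le_trans (hC _) _.
  by case: coE => -> //; rewrite mulr1.
exists B; split=> //; exists E, (fun e => `|A e| ^+ 2); split=> // e Ee.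
split; [exact: sqr_ge0|exact: hE|exact: (diagonal_op_eigen coE hB)].
Qed.

Lemma op_powerP A (s : R) : compact_op A -> 0 <= s ->
  is_op_power (adjoint A \o A) s (op_power (adjoint A \o A) s).
Proof. by move=> cA s0; apply: getPex; exact: op_power_exists. Qed.

End spectral.

(** * Traces *)

Section finite_sums.
Context {R : realType} {T : choiceType}.
Implicit Types (f : T -> R) (s t : seq T) (D : set T).

Lemma ler_sum_sub f s t : uniq s -> uniq t -> {subset s <= t} ->
  (forall i, i \in t -> 0 <= f i) ->
  \sum_(i <- s) f i <= \sum_(i <- t) f i.
Proof.
move=> us ut st f0; rewrite [leRHS](bigID (mem s))/=.
have -> : \sum_(i <- t | i \in s) f i = \sum_(i <- s) f i.
  rewrite -big_filter; apply: perm_big; apply: uniq_perm => //.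
    exact: filter_uniq.
  by move=> i; rewrite mem_filter; case: (boolP (i \in s)) => //= /st ->.
by rewrite lerDl big_seq_cond sumr_ge0// => i /andP[/f0].
Qed.

Lemma ler_sum_term f s i : i \in s -> (forall j, 0 <= f j) ->
  f i <= \sum_(j <- s) f j.
Proof. by move=> si f0; rewrite (big_rem i)//= lerDl sumr_ge0. Qed.

Lemma esum_leP D f (K : \bar R) :
  (\esum_(i in D) (f i)%:E <= K)%E <->
  (forall s, uniq s -> (forall i, i \in s -> D i) ->
     ((\sum_(i <- s) f i)%:E <= K)%E).
Proof.
split=> [h s us sD|h].
  apply: le_trans h; apply: ereal_sup_ubound; exists [set` s].
    by split; [exact: finite_seq|move=> i /sD].
  by rewrite -fsbig_seq// sumEFin.
apply: ge_ereal_sup => _ [F [/finite_seqP[s ->] sD] <-].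
have <- : [set` undup s] = [set` s].
  by apply/seteqP; split => i /=; rewrite mem_undup.
rewrite -fsbig_seq ?undup_uniq// sumEFin; apply: h; first exact: undup_uniq.
by move=> i; rewrite mem_undup => /sD.
Qed.

End finite_sums.

(** [K] may depend on the finite list on the left, so constants like its length or its sum are
    harmless. *)
Lemma esum_approx {R : realType} (T1 T2 : choiceType) (D1 : set T1)
    (D2 : set T2) (f1 : T1 -> R) (f2 : T2 -> R) :
  (forall s, uniq s -> (forall i, i \in s -> D1 i) -> exists K, forall eps,
    0 < eps -> exists t, [/\ uniq t, (forall i, i \in t -> D2 i) &
      \sum_(i <- s) f1 i <= \sum_(i <- t) f2 i + K * eps]) ->
  (\esum_(i in D1) (f1 i)%:E <= \esum_(i in D2) (f2 i)%:E)%E.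
Proof.
move=> h; apply/esum_leP => s us sD; have [K hK] := h s us sD.
have /esum_leP : (\esum_(i in D2) (f2 i)%:E <= \esum_(i in D2) (f2 i)%:E)%E by
  [].
case: (\esum_(i in D2) (f2 i)%:E) => [b hb| |hb].
- rewrite lee_fin -subr_le0;
    apply: (@le0_of_le_eps _ _ K) => eps /hK[t [ut tD ht]].
  by have := hb t ut tD; rewrite lee_fin; move: ht; lra.
- by rewrite leey.
- by have := hb [::] isT (fun _ => ltac:(by [])); rewrite big_nil.
Qed.

Section trace.
Context {R : realType} {H : hilbertType R}.
Implicit Types (x y z v e : H) (s t : seq H) (A B : H -> H) (E F : set H).

Section fixed_diagonal.
Variables (E : set H) (B : H -> H) (mu : H -> R).
Hypotheses (coE : complete_orthonormal E) (bB : bounded_op B).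
Hypotheses (mu0 : forall e, E e -> 0 <= mu e).
Hypotheses (Be : forall e, E e -> B e = mu e *: e).

(** The diagonal form of [<x, B x>], uniformly over the finitely many [x] in [l] and over all large
    lists of eigenvectors. *)
Lemma quadratic_approx (l : seq H) : exists2 K, 0 <= K & forall eps, 0 < eps ->
  exists2 s, ulist E s & forall x t, x \in l -> ulist E t -> {subset s <= t} ->
    `|inner x (B x) - \sum_(e <- t) mu e * inner x e ^+ 2| <= K * eps.
Proof.
have [C C0 hC] := bop_bounded bB.
exists (C * \sum_(x <- l) `|x|); first by rewrite mulr_ge0 ?(ltW C0)// sumr_ge0.
move=> eps e0; have [s us hs] := expansions coE l e0;
  exists s => // x t xl ut st.
have -> : \sum_(e <- t) mu e * inner x e ^+ 2 = inner x (B (comb (inner x) t)).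
  rewrite /comb (bop_sum bB) inner_sumr big_seq [RHS]big_seq.
  apply: eq_bigr => e et; rewrite (bopZ bB) Be; last exact: ut.2.
  by rewrite !innerZr; ring.
rewrite -innerBr -(bopB bB); apply: le_trans (cauchy_schwarz _ _) _.
rewrite (mulrC C) -mulrA; apply: ler_pM => //.
  exact: (@ler_sum_term _ _ (fun x : H => `|x|) l).
apply: le_trans (hC _) _; rewrite ler_pM2l//; exact/ltW/hs.
Qed.

Lemma quadratic_ge x t : ulist E t ->
  \sum_(e <- t) mu e * inner x e ^+ 2 <= inner x (B x).
Proof.
move=> ut; rewrite -subr_le0; have [K K0 hK] := quadratic_approx [:: x].
apply: (@le0_of_le_eps _ _ K) => eps /hK[s us hs].
have [u [uu su tu]] := ulist_union us ut.
have := hs x u (mem_head _ _) uu su; rewrite ler_norml => /andP[h _].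
have := @ler_sum_sub _ _ (fun e => mu e * inner x e ^+ 2) t u ut.1 uu.1 tu.
move=> /(_ _)/wrap[|h'].
  by move=> e /uu.2 Ee; rewrite mulr_ge0 ?sqr_ge0// mu0.
by move: h h'; lra.
Qed.

(** Both sides are the double sum of [mu e * <e, f>^2]. One inequality uses Bessel for each [e] in
    the system [F]; the other takes so many [f] that each [e] of a finite list is nearly exhausted,
    and bounds the remaining sums over [e] by [<f, B f>]. *)
Lemma trace_diagonal F : complete_orthonormal F ->
  (\esum_(f in F) (inner f (B f))%:E = \esum_(e in E) (mu e)%:E)%E.
Proof.
move=> coF; apply/eqP; rewrite eq_le; apply/andP; split; apply: esum_approx.
- move=> s us sF; have [K K0 hK] := quadratic_approx s.
  exists ((size s)%:R * K) => eps /hK[t ut ht]; exists t; split;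
    [exact: ut.1|exact: ut.2|].
  apply: (@le_trans _ _ (\sum_(f <- s) (\sum_(e <- t) mu e * inner f e ^+ 2 + K
    * eps))).
    rewrite big_seq [leRHS]big_seq; apply: ler_sum => f fs.
    by have := ht f t fs ut (fun _ => id); rewrite ler_norml => /andP[_]; lra.
  rewrite big_split/= big_const_seq count_predT iter_addr_0 -[(K * eps) *+
    _]mulr_natl mulrA lerD2r.
  rewrite exchange_big/= big_seq [leRHS]big_seq; apply: ler_sum => e et.
  rewrite -mulr_sumr ler_piMr//; first exact/mu0/ut.2.
  under eq_bigr do rewrite innerC.
  apply: le_trans (bessel (complete_on coF) e (conj us sF)) _.
  have -> : `|e| = 1 by case: coE => -> //; exact: ut.2.
  by rewrite expr1n.
- move=> t ut tE; exists (\sum_(e <- t) mu e) => eps e0.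
  pose del := Num.min eps 1.
  have d0 : 0 < del by rewrite lt_min e0 ltr01.
  have de : del <= eps by rewrite ge_min lexx.
  have d1 : del <= 1 by rewrite ge_min lexx orbT.
  have [s us hs] := expansions coF t d0; exists s; split;
    [exact: us.1|exact: us.2|].
  apply: (@le_trans _ _ (\sum_(e <- t) mu e * (\sum_(f <- s) inner e f ^+ 2 +
    eps))).
    rewrite big_seq [leRHS]big_seq; apply: ler_sum => e et.
    rewrite ler_peMr//; first exact/mu0/tE.
    (* As [|e| = 1], the missing mass [1 - \sum <e, f>^2] is below [del^2 <= del <= eps]. *)
    have := hs e s et us (fun _ => id);
      rewrite -(@ltr_pXn2r _ 2) ?nnegrE ?(ltW d0)//.
    rewrite (proj_norm (complete_on coF))//.
    have -> : `|e| = 1 by case: coE => -> //; exact: tE.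
    by have := ltW d0; rewrite expr1n !expr2; nra.
  under eq_bigr do rewrite mulrDr mulr_sumr.
  rewrite big_split/= -mulr_suml lerD2r exchange_big/=.
  apply: ler_sum => f _; under eq_bigr do rewrite innerC.
  exact: (quadratic_ge _ (conj ut tE)).
Qed.

End fixed_diagonal.
End trace.

(** * Schatten norms *)

(** The convex power function lies above its tangent at [t]. For [r > 1] this is Young's inequality
    for [s] and [t^(r-1)] with exponents [r] and [r / (r - 1)]; the second degenerates at [r = 1],
    treated apart. *)
Lemma young_tangent {R : realType} (r s t : R) : 1 <= r -> 0 <= s -> 0 <= t ->
  r * t `^ (r - 1) * s <= s `^ r + (r - 1) * t `^ r.
Proof.
move=> r1 s0 t0; have [->|rn1] := eqVneq r 1.
  by rewrite subrr powRr0 powRr1// mul0r addr0 !mul1r.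
have {rn1}r1' : 1 < r by rewrite lt_neqAle eq_sym rn1.
have r0 : 0 < r by apply: lt_trans r1'.
have r10 : 0 < r - 1 by rewrite subr_gt0.
have q0 : 0 < r / (r - 1) by rewrite divr_gt0.
have /(_ _)/wrap[|h] := @conjugate_powR _ s (t `^ (r - 1)) r _ s0 (powR_ge0 _
  _) r0 q0.
  by field; rewrite !gt_eqF.
have e1 : (t `^ (r - 1)) `^ (r / (r - 1)) = t `^ r.
  by rewrite -powRrM; congr (_ `^ _); field; rewrite gt_eqF.
have := ler_wpM2l (ltW r0) h; rewrite e1.
have -> : r * (s `^ r / r + t `^ r / (r / (r - 1))) = s `^ r + (r - 1) * t `^ r.
  by field; rewrite !gt_eqF.
by apply: le_trans; rewrite mulrAC -mulrA.
Qed.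

Section schatten_pairing.
Context {R : realType} {H : hilbertType R}.
Implicit Types (x y z v e : H) (A B : H -> H) (E F : set H).

(** Weaker than orthonormality: it admits zero vectors, such as missing singular vectors, and is
    preserved by contractions, on which the ideal property rests. *)
Definition bessel_family (I : Type) (s : seq I) (f : I -> H) :=
  forall x, \sum_(i <- s) inner x (f i) ^+ 2 <= `|x| ^+ 2.

Definition pairing_bound (r : R) A (K : R) := forall s : seq (H * H),
  bessel_family s fst -> bessel_family s snd ->
  \sum_(z <- s) `|inner (A z.1) z.2| `^ r <= K.

(** Testing with [x = f i] gives [|f i|^4 <= |f i|^2]. *)
Lemma bessel_family_le1 (I : choiceType) (s : seq I) (f : I -> H) i :
  bessel_family s f -> i \in s -> `|f i| <= 1.
Proof.
move=> bf si; have := bf (f i).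
move=> /(le_trans (@ler_sum_term _ _ (fun j => inner (f i) (f j) ^+ 2) _ _ si
  (fun j => sqr_ge0 _))).
rewrite inner_norm => h; rewrite leNgt; apply/negP => f1.
move: h; rewrite leNgt => /negP; apply.
by rewrite -{1}[_ ^+ 2]expr1 ltr_eXn2l// exprn_egt1.
Qed.

(** With [y] the sum of [<x, v e> v e], both [<x, y> = S] and [|y|^2 <= S]; then [|x - y|^2 >= 0]
    yields [S <= |x|^2]. *)
Lemma bessel_orthogonal (s : seq H) (v : H -> H) : uniq s ->
  (forall e f, e \in s -> f \in s -> e != f -> inner (v e) (v f) = 0) ->
  (forall e, e \in s -> `|v e| <= 1) -> bessel_family s v.
Proof.
move=> us ov nv x; set S := \sum_(_ <- _) _.
pose y := \sum_(e <- s) inner x (v e) *: v e.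
have xy : inner x y = S.
  by rewrite inner_sumr; apply: eq_bigr => e _; rewrite innerZr.
have yy : `|y| ^+ 2 <= S.
  rewrite -inner_norm {2}/y inner_sumr big_seq [leRHS]big_seq.
  apply: ler_sum => e es; rewrite innerZr.
  have -> : inner y (v e) = inner x (v e) * `|v e| ^+ 2.
    rewrite inner_suml (bigD1_seq e)//= innerZl inner_norm big_seq_cond.
    rewrite big1 ?addr0// => f /andP[fs fe].
    by rewrite innerZl ov// mulr0.
  rewrite mulrA -expr2 ler_piMr ?sqr_ge0//.
  by rewrite exprn_ile1// nv.
by have := sqr_ge0 (`|x - y|); rewrite sqr_normB xy; move: yy; lra.
Qed.

Section compact.
Variables (r : R) (A : H -> H).
Hypotheses (r1 : 1 <= r) (cA : compact_op A).
Let bA := cA.1.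
Let r0 : 0 < r. Proof. exact: lt_le_trans r1. Qed.

Section diagonalization.
Variable E : set H.
Hypotheses (coE : complete_orthonormal E).
Hypotheses (hE : forall e, E e -> adjoint A (A e) = (`|A e| ^+ 2) *: e).

(* Left singular vectors, [0] where [A e = 0]. *)
Let v e := `|A e|^-1 *: A e.

Let Av e : A e = `|A e| *: v e.
Proof.
rewrite /v scalerA; have [->|An] := eqVneq (A e) 0; first by rewrite scaler0.
by rewrite mulfV ?normr_eq0// scale1r.
Qed.

Let v1 e : `|v e| <= 1.
Proof.
rewrite normrZ normfV normr_id; have [->|An] := eqVneq (A e) 0.
  by rewrite normr0 mulr0.
by rewrite mulVf ?normr_eq0.
Qed.

Let ov e f : E e -> E f -> e != f -> inner (v e) (v f) = 0.
Proof.
move=> Ee Ef ef; rewrite innerZl innerZr adjointP// hE// innerZr.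
by case: coE => _ -> //; [rewrite !mulr0|apply/eqP].
Qed.

Let v_bessel s : ulist E s -> bessel_family s v.
Proof.
move=> us; apply: bessel_orthogonal => [|e f es fs ef|//]; first exact: us.1.
by apply: ov => //; exact: us.2.
Qed.

Let pairing_diagonal e : inner (A e) (v e) = `|A e|.
Proof.
rewrite innerZr inner_norm; have [->|An] := eqVneq (A e) 0.
  by rewrite normr0 expr0n mulr0.
by rewrite expr2 mulrA mulVf ?normr_eq0// mul1r.
Qed.

Lemma pairing_bound_sum K s : pairing_bound r A K -> ulist E s ->
  \sum_(e <- s) `|A e| `^ r <= K.
Proof.
move=> pb us; have := pb [seq (e, v e) | e <- s].
rewrite big_map /= => h; apply: le_trans (h _ _) => [|x|x]; last 2 first.
- by rewrite big_map; exact: (bessel (complete_on coE)).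
- by rewrite big_map; exact: v_bessel.
by apply: ler_sum => e _; rewrite pairing_diagonal normr_id.
Qed.

(* The matrix [|<x, e>| |<v e, y>|] is doubly substochastic, so by convexity
   it does not increase the sum of [r]-th powers of singular values. *)
Lemma sum_pairing_bound K :
  (forall s, ulist E s -> \sum_(e <- s) `|A e| `^ r <= K) -> pairing_bound r A
    K.
Proof.
move=> hK s b1 b2; have [C C0 hC] := bop_bounded bA.
rewrite -subr_le0.
(* The truncation error [C * eps] times the largest slope [r C^(r-1)] of the power function on
   [[0, C]]. *)
pose K1 := r * C `^ (r - 1) * C.
apply: (@le0_of_le_eps _ _ ((size s)%:R * K1)) => eps e0.
have [t ut ht] := expansions coE (map fst s) e0.
pose a (z : H * H) e := `|inner z.1 e| * `|inner (v e) z.2|.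
have a0 (z : H * H) e : 0 <= a z e by rewrite mulr_ge0.
(* By this inequality a row or column sum of [a] is at most the mean of two Bessel sums, each at
   most [1]. *)
have ale (z : H * H) e : a z e <= (inner z.1 e ^+ 2 + inner z.2 (v e) ^+ 2) / 2.
  rewrite /a -(real_normK (num_real (inner z.1 e))) (innerC z.2).
  rewrite -(real_normK (num_real (inner (v e) _))).
  by have := sqr_ge0 (`|inner z.1 e| - `|inner (v e) z.2|); rewrite sqrrB; lra.
have key (z : H * H) : z \in s -> `|inner (A z.1) z.2| `^ r <=
    \sum_(e <- t) a z e * `|A e| `^ r + K1 * eps.
  move=> zs; set T := `|inner _ _|.
  have z1 : `|z.1| <= 1 by exact: bessel_family_le1 b1 zs.
  have z2 : `|z.2| <= 1 by exact: bessel_family_le1 b2 zs.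
  have T0 : 0 <= T by exact: normr_ge0.
  have TC : T <= C.
    apply: le_trans (cauchy_schwarz _ _) _;
      apply: le_trans (ler_piMr _ z2) _ => //.
    by apply: le_trans (hC _) _; rewrite ler_piMr// ltW.
  have hT : T <= C * eps + \sum_(e <- t) a z e * `|A e|.
    have hz : `|z.1 - comb (inner z.1) t| < eps.
      by apply: ht => //; apply: map_f.
    have -> : T = `|inner (A (z.1 - comb (inner z.1) t)) z.2
        + inner (A (comb (inner z.1) t)) z.2|.
      by rewrite -innerDl -(bopD bA) subrK.
    apply: le_trans (ler_normD _ _) _; apply: lerD.
      apply: le_trans (cauchy_schwarz _ _) _;
        apply: le_trans (ler_piMr _ z2) _ => //.
      by apply: le_trans (hC _) _; rewrite ler_pM2l// ltW.
    rewrite /comb (bop_sum bA) inner_suml;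
      apply: le_trans (ler_norm_sum _ _ _) _.
    apply: ler_sum => e _; rewrite (bopZ bA) innerZl.
    have -> : inner (A e) z.2 = `|A e| * inner (v e) z.2 by rewrite -innerZl
      -Av.
    by rewrite !normrM normr_id /a [leRHS]mulrC mulrCA.
  have row : \sum_(e <- t) a z e <= 1.
    apply: le_trans (ler_sum _ (fun e _ => ale z e)) _.
    rewrite -mulr_suml big_split/= ler_pdivrMr// mul1r.
    have h1 := bessel (complete_on coE) z.1 ut.
    have h2 := v_bessel ut z.2.
    have h3 : `|z.1| ^+ 2 <= 1 by rewrite exprn_ile1.
    have h4 : `|z.2| ^+ 2 <= 1 by rewrite exprn_ile1.
    by lra.
  (* The slope at [T]. Averaging the tangent inequality at [T] with weights [a z e] of total at most
     [1] is Jensen's inequality; since [W T = r T^r], moving [(r - 1) T^r] across leaves [T^r]. *)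
  pose W := r * T `^ (r - 1).
  have W0 : 0 <= W by rewrite mulr_ge0 ?powR_ge0// ltW.
  have WT : W * T = r * T `^ r.
    by rewrite /W -mulrA [_ * T]mulrC mulr_powRB1.
  have WC : W * C <= K1.
    rewrite /K1 /W ler_pM2r// ler_pM2l// ge0_ler_powR ?nnegrE ?(ltW C0)//.
    by rewrite subr_ge0.
  have hs : W * \sum_(e <- t) a z e * `|A e| <=
      \sum_(e <- t) a z e * `|A e| `^ r + (r - 1) * T `^ r.
    rewrite mulr_sumr.
    apply: (@le_trans _ _ (\sum_(e <- t) (a z e * `|A e| `^ r
        + a z e * ((r - 1) * T `^ r)))).
      apply: ler_sum => e _; rewrite mulrCA -mulrDr ler_wpM2l//.
      exact: young_tangent.
    rewrite big_split/= lerD2l -mulr_suml ler_piMl//.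
    by rewrite mulr_ge0 ?powR_ge0// subr_ge0.
  have h1 := ler_wpM2l W0 hT; rewrite WT mulrDr mulrA in h1.
  have h2 : W * C * eps <= K1 * eps by rewrite ler_pM2r.
  by lra.
apply: (@le_trans _ _ (\sum_(z <- s) (\sum_(e <- t) a z e * `|A e| `^ r + K1 *
  eps) - K)).
  by rewrite lerD2r big_seq [leRHS]big_seq; apply: ler_sum.
rewrite big_split/= big_const_seq count_predT iter_addr_0 -[(K1 * eps) *+
  _]mulr_natl mulrA.
rewrite addrAC gerDr subr_le0; apply: le_trans (hK _ ut);
  rewrite exchange_big/=.
rewrite big_seq [leRHS]big_seq; apply: ler_sum => e et.
rewrite -mulr_suml ler_piMl ?powR_ge0//.
apply: le_trans (ler_sum _ (fun (z : H * H) _ => ale z e)) _.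
rewrite -mulr_suml big_split/= ler_pdivrMr// mul1r.
have h1 := b1 e; have h2 := b2 (v e).
have h3 : `|e| = 1 by case: coE => -> //; exact: ut.2.
have h4 : `|v e| ^+ 2 <= 1 by rewrite exprn_ile1.
under eq_bigr do rewrite innerC.
rewrite [X in _ + X](eq_bigr (fun z : H * H => inner (v e) z.2 ^+ 2));
  last first.
  by move=> z _; rewrite innerC.
by rewrite h3 expr1n in h1; lra.
Qed.

End diagonalization.

(** The power is known only through some eigenbasis [E]. There the eigenvalues must be [|A e|^2],
    and basis independence of the trace carries the sum from [onsystem] to [E]. *)
Lemma esum_op_power : exists E, [/\ complete_orthonormal E,
  forall e, E e -> adjoint A (A e) = (`|A e| ^+ 2) *: e &
  (\esum_(e in onsystem H)
     (inner e (op_power (adjoint A \o A) (r / 2) e))%:E =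
   \esum_(e in E) (`|A e| `^ r)%:E)%E].
Proof.
have [|bB [E [lam [coE hE]]]] := op_powerP (s := r / 2) cA.
  by rewrite divr_ge0// ltW.
have lamE e : E e -> lam e = `|A e| ^+ 2.
  move=> Ee; have [_ /= Te _] := hE e Ee.
  rewrite -inner_norm adjointP// Te innerZr inner_norm.
  by case: coE => -> //; rewrite expr1n mulr1.
have muE e : E e -> lam e `^ (r / 2) = `|A e| `^ r.
  move=> /lamE ->; rewrite -powR_mulrn// -powRrM; congr (_ `^ _).
  by field.
exists E; split=> //.
- by move=> e Ee; rewrite -lamE//; have [] := hE e Ee.
- apply: (trace_diagonal coE bB) onsystemP => e Ee; first exact: powR_ge0.
  by rewrite -muE//; have [] := hE e Ee.
Qed.

End compact.

Lemma schatten_leP r A C : 1 <= r -> 0 <= C ->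
  (schatten r%:E A <= C%:E)%E <-> compact_op A /\ pairing_bound r A (C `^ r).
Proof.
move=> r1 C0; have r0 : 0 < r by exact: lt_le_trans r1.
rewrite /schatten; case: asboolP => [cA|ncA]; last first.
  by rewrite leye_eq; split => // -[].
have [E [coE hE ->]] := esum_op_power r1 cA.
have -> : (poweR (\esum_(e in E) (`|A e| `^ r)%:E) r^-1 <= C%:E)%E =
    (\esum_(e in E) (`|A e| `^ r)%:E <= (C `^ r)%:E)%E.
  have : (0 <= \esum_(e in E) (`|A e| `^ r)%:E)%E.
    by apply: esum_ge0 => e _; rewrite lee_fin powR_ge0.
  case: (\esum_(e in E) _)%E => [b| |]//.
  - rewrite !lee_fin => b0.
    apply/idP/idP => h.
      have /(ge0_ler_powR (ltW r0)) : b `^ r^-1 <= C by [].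
      rewrite !nnegrE powR_ge0 => /(_ isT C0).
      by rewrite -powRrM mulVf ?gt_eqF// powRr1.
    have ri : 0 <= r^-1 by rewrite invr_ge0 ltW.
    have /(ge0_ler_powR ri) := h.
    rewrite !nnegrE powR_ge0 => /(_ b0 isT).
    by rewrite -powRrM mulfV ?gt_eqF// powRr1.
  - by rewrite poweRyr ?invr_eq0 ?gt_eqF.
split=> [h|[_ pb]].
  split=> //; apply: (sum_pairing_bound r1 cA coE hE) => s us.
  by rewrite -lee_fin; apply: (esum_leP _ _ _).1 h _ us.1 us.2.
apply/esum_leP => s us sE; rewrite lee_fin.
exact: (pairing_bound_sum cA coE hE pb (conj us sE)).
Qed.

End schatten_pairing.

(** * Tikhonov regularization *)

Section schatten_rules.
Context {R : realType} {H : hilbertType R}.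
Implicit Types (x y : H) (A B : H -> H) (a b c C : R) (p : \bar R).

(* For bounded [A] and [0 <= C] this says [schatten p A <= C]. *)
Definition schatten_bound p A C : Prop :=
  match p with
  | r%:E => compact_op A /\ pairing_bound r A (C `^ r)
  | +oo%E => forall x, `|A x| <= C * `|x|
  | -oo%E => True
  end.

Lemma opnorm_leP A C : bounded_op A -> 0 <= C ->
  (opnorm A <= C%:E)%E <-> forall x, `|A x| <= C * `|x|.
Proof.
move=> bA C0; split=> [h x|h].
  have [->|xn] := eqVneq x 0; first by rewrite (bop0 bA) !normr0 mulr0.
  have nx : 0 < `|x| by rewrite normr_gt0.
  have : (`|A (`|x|^-1 *: x)|%:E <= C%:E)%E.
    apply: le_trans h; apply: ereal_sup_ubound; exists (`|x|^-1 *: x) => //=.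
    by rewrite normrZ normfV normr_id mulVf ?gt_eqF.
  by rewrite lee_fin (bopZ bA) normrZ normfV normr_id mulrC ler_pdivrMr.
apply: ge_ereal_sup => _ [x /= x1 <-]; rewrite lee_fin.
by apply: le_trans (h x) _; rewrite ler_piMr.
Qed.

Lemma schattenP p A C : (1 <= p)%E -> bounded_op A -> 0 <= C ->
  (schatten p A <= C%:E)%E <-> schatten_bound p A C.
Proof.
case: p => [r| |//]; first by rewrite lee_fin => r1 _; exact: schatten_leP.
by move=> _ bA C0; exact: opnorm_leP.
Qed.

Lemma schatten_ge0 p A : bounded_op A -> (0 <= schatten p A)%E.
Proof.
move=> bA; case: p => [r| |] //=; first by case: ifP => // _; exact: poweR_ge0.
by apply: ereal_sup_ubound; exists 0; rewrite /= ?(bop0 bA) normr0.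
Qed.

Lemma schatten_bound_adjoint p A C : bounded_op A ->
  schatten_bound p A C -> 0 <= C -> schatten_bound p (adjoint A) C.
Proof.
case: p => [r| |] //= bA; last by move=> h C0; exact: adjoint_bound.
move=> [cA pb] C0; split; first exact: compact_op_adjoint.
move=> s b1 b2; have := pb [seq (z.2, z.1) | z <- s].
rewrite big_map /= => h; apply: le_trans (h _ _) => [|x|x]; last 2 first.
- by rewrite big_map; exact: b2.
- by rewrite big_map; exact: b1.
by apply: ler_sum => z _; rewrite -(adjointPr _ _ bA) innerC.
Qed.

Lemma schatten_adjoint p A : (1 <= p)%E -> bounded_op A ->
  schatten p (adjoint A) = schatten p A.
Proof.
move=> p1; have le B : bounded_op B -> (schatten p (adjoint B) <= schatten p
  B)%E.
  move=> bB; have := schatten_ge0 p bB.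
  have : (schatten p B <= schatten p B)%E by [].
  case: {2 3 4}(schatten p B) => [c| |]; [|by move=> _ _; rewrite leey|by []].
  rewrite lee_fin => /schattenP h c0; apply/schattenP => //;
    first exact: bop_adjoint.
  by apply: schatten_bound_adjoint => //; exact: h.
move=> bA; apply/eqP; rewrite eq_le le//=.
by have := le _ (bop_adjoint bA); rewrite adjointK.
Qed.

(** [<B A e, g> = b <A e, b^-1 B^* g>], and the vectors [b^-1 B^* g] again form a Bessel family
    since [b^-1 B] is a contraction. *)
Lemma schatten_bound_compl p A B a b : bounded_op A -> bounded_op B ->
  0 < b -> 0 <= a -> (forall x, `|B x| <= b * `|x|) ->
  schatten_bound p A a -> schatten_bound p (B \o A) (b * a).
Proof.
move=> bA bB b0 a0 hB; case: p => [r| |] //=; last first.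
  by move=> hA x; apply: le_trans (hB _) _; rewrite -mulrA ler_pM2l.
move=> [cA pb]; split; first exact: compact_op_compl.
move=> s b1 b2; have := pb [seq (z.1, b^-1 *: adjoint B z.2) | z <- s].
rewrite big_map /= => /(_ _)/wrap[x|].
  by rewrite big_map; exact: b1.
move=> /(_ _)/wrap[x|h].
  rewrite big_map/=.
  rewrite (eq_bigr (fun z : H * H => inner (b^-1 *: B x) z.2 ^+ 2)); last first.
    by move=> z _; rewrite innerZr innerZl adjointP.
  apply: le_trans (b2 _) _; rewrite ler_pXn2r ?nnegrE//.
  by rewrite normrZ gtr0_norm ?invr_gt0// mulrC ler_pdivrMr// mulrC.
rewrite powRM// ?(ltW b0)//; apply: (@le_trans _ _ (b `^ r *
    \sum_(z <- s) `|inner (A z.1) (b^-1 *: adjoint B z.2)| `^ r)); last first.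
  by rewrite ler_wpM2l// powR_ge0.
rewrite mulr_sumr; apply: ler_sum => z _.
rewrite -powRM// ?(ltW b0)// innerZr -adjointP// normrM gtr0_norm ?invr_gt0//.
by rewrite mulrA mulfV ?gt_eqF// mul1r.
Qed.

Lemma schatten_bound_compr p A B a b : bounded_op A -> bounded_op B ->
  0 < b -> 0 <= a -> (forall x, `|B x| <= b * `|x|) ->
  schatten_bound p A a -> schatten_bound p (A \o B) (b * a).
Proof.
move=> bA bB b0 a0 hB hA.
have -> : A \o B = adjoint (adjoint B \o adjoint A).
  by rewrite adjoint_comp ?adjointK//; exact: bop_adjoint.
apply: schatten_bound_adjoint; last by rewrite mulr_ge0// ltW.
  by apply: bop_comp; exact: bop_adjoint.
apply: schatten_bound_compl => //; try exact: bop_adjoint.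
  by apply: adjoint_bound => //; exact: ltW.
exact: schatten_bound_adjoint.
Qed.

(* Only a quasi-triangle inequality: constants are immaterial for rates. *)
Lemma schatten_bound_add p A B a b : (1 <= p)%E -> 0 <= a -> 0 <= b ->
  schatten_bound p A a -> schatten_bound p B b ->
  schatten_bound p (A + B) (2 * (a + b)).
Proof.
move=> p1 a0 b0; case: p p1 => [r| |] //=; last first.
  move=> _ hA hB x; rewrite -[(A + B) x]/(A x + B x).
  apply: le_trans (ler_normD _ _) _; apply: (@le_trans _ _ ((a + b) * `|x|)).
    by rewrite mulrDl lerD.
  by rewrite ler_wpM2r//; lra.
rewrite lee_fin => r1 [cA pA] [cB pB]; split; first exact: compact_op_add.
have r0 : 0 <= r by exact: le_trans r1.
move=> s b1 b2.
apply: (@le_trans _ _ (2 `^ r * (\sum_(z <- s) `|inner (A z.1) z.2| `^ r +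
    \sum_(z <- s) `|inner (B z.1) z.2| `^ r))).
  rewrite -big_split/= mulr_sumr; apply: ler_sum => z _.
  rewrite -[(A + B) _]/(A z.1 + B z.1) innerDl.
  set u := inner (A _) _; set v := inner (B _) _.
  apply: (@le_trans _ _ ((2 * Num.max `|u| `|v|) `^ r)).
    apply: ge0_ler_powR; rewrite ?nnegrE ?mulr_ge0// ?le_max ?normr_ge0//.
    apply: le_trans (ler_normD _ _) _; rewrite mulr_natl mulr2n.
    by rewrite lerD// le_max lexx ?orbT.
  rewrite powRM// ?le_max ?normr_ge0// ler_wpM2l ?powR_ge0//.
  by rewrite maxEle; case: ifP => _; rewrite ?lerDl ?lerDr ?powR_ge0.
rewrite powRM ?addr_ge0// ler_wpM2l ?powR_ge0//.
apply: (@le_trans _ _ (a `^ r + b `^ r)).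
  by apply: lerD; [exact: pA|exact: pB].
have ab0 : 0 <= a + b by exact: addr_ge0.
(* Superadditivity of the power: [a * a^(r-1) <= a * (a + b)^(r-1)], and likewise for [b]. *)
rewrite -!(mulr_powRB1 _ (lt_le_trans ltr01 r1))// mulrDl.
have r10 : 0 <= r - 1 by rewrite subr_ge0.
by rewrite lerD// ler_wpM2l// ge0_ler_powR ?nnegrE// ?lerDl ?lerDr.
Qed.

Lemma schatten_bound_opp p A a : bounded_op A -> 0 <= a ->
  schatten_bound p A a -> schatten_bound p (- A) a.
Proof.
move=> bA a0 hA; have -> : - A = (- (idfun : H -> H)) \o A by [].
rewrite -[a]mul1r; apply: schatten_bound_compl => //.
  by apply: bop_opp; exact: bop_id.
by move=> x; rewrite mul1r -[(- _) x]/(- x) normrN.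
Qed.

End schatten_rules.

(** * The regularized inverse and the error decomposition *)

Section tikhonov.
Context {R : realType} {H : hilbertType R}.
Implicit Types (x y : H) (A B : H -> H) (p : \bar R).

Section inverse.
Variables (A : H -> H) (a : R).
Hypotheses (a0 : 0 < a) (cA : compact_op A) (sA : selfadjoint A).
Let bA := cA.1.
Let S := A \o A + a *: (idfun : H -> H).
Let Sinv := pinv setT S.

Let S_coercive x : inner (S x) x = `|A x| ^+ 2 + a * `|x| ^+ 2.
Proof.
rewrite -[S x]/(A (A x) + a *: x) innerDl innerZl inner_norm.
by rewrite sA inner_norm.
Qed.

Let bS : bounded_op S.
Proof.
by apply: bop_add; [exact: bop_comp|apply: bop_scale; exact: bop_id].
Qed.

Let S_inj : injective S.
Proof.
move=> x y xy; apply/eqP; rewrite -subr_eq0 -normr_eq0 -sqrf_eq0.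
have := S_coercive (x - y); rewrite (bopB bS) xy subrr inner0l => h.
rewrite eq_le sqr_ge0 andbT -(ler_pM2l a0) mulr0.
by have := sqr_ge0 (`|A (x - y)|); lra.
Qed.

(** Coercivity gives injectivity only. Surjectivity comes from an eigenbasis of [A A], on which [S]
    multiplies by [|A e|^2 + a]; the diagonal operator of the reciprocals is a right inverse, hence
    equals [pinv]. *)
Let SinvP : bounded_op Sinv /\ forall y, S (Sinv y) = y.
Proof.
have [E [coE hE]] := spectral_theorem cA; rewrite (adjoint_self sA) in hE.
have d0 e : 0 < `|A e| ^+ 2 + a by rewrite ltr_wpDl// sqr_ge0.
have [|e Ee|B [bB hB]] := @diagonal_op R H E (fun e => (`|A e| ^+ 2 + a)^-1)
  a^-1 coE.
- by rewrite invr_ge0 ltW.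
- rewrite gtr0_norm ?invr_gt0// lef_pV2 ?posrE// lerDr sqr_ge0//.
have SB y : S (B y) = y.
  apply: (complete_inj coE) => e Ee.
  rewrite -[S (B y)]/(A (A (B y)) + a *: B y) innerDl innerZl !sA hE// innerZr.
  by rewrite -mulrDl hB// mulrA mulfV ?gt_eqF// mul1r.
have -> : Sinv = B.
  apply/funext => y; rewrite -{1}(SB y) /Sinv.
  by apply: pinvKV; rewrite ?inE//; apply: in2W.
by [].
Qed.

Lemma bop_tikhonov_inverse : bounded_op Sinv.
Proof. by case: SinvP. Qed.

Lemma tikhonov_inverseK y : Sinv (A (A y) + a *: y) = y.
Proof.
rewrite -[A (A y) + a *: y]/(S y) /Sinv.
by apply: pinvKV; rewrite ?inE//; apply: in2W.
Qed.

Lemma tikhonov_inverse_le y : `|Sinv y| <= a^-1 * `|y|.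
Proof.
have [bI SI] := SinvP; have := S_coercive (Sinv y); rewrite SI => h.
have := inner_le y (Sinv y); rewrite h => {}h.
have [->|xn] := eqVneq (Sinv y) 0;
  first by rewrite normr0 mulr_ge0// invr_ge0 ltW.
rewrite mulrC ler_pdivlMr// mulrC.
have xp : 0 < `|Sinv y| by rewrite normr_gt0.
rewrite -(ler_pM2r xp) -mulrA -expr2; apply: le_trans h.
by rewrite lerDr sqr_ge0.
Qed.

(** For [x = S^-1 A y], pairing [S x = A y] with [x] gives [|A x|^2 + a |x|^2 = <y, A x>], and
    [|y| |A x| - |A x|^2 <= |y|^2 / 4]. *)
Lemma tikhonov_filter_le y : `|Sinv (A y)| <= (Num.sqrt a)^-1 * `|y|.
Proof.
have [bI SI] := SinvP; have := S_coercive (Sinv (A y)).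
set x := Sinv (A y); rewrite SI sA => h.
have s0 : 0 < Num.sqrt a by rewrite sqrtr_gt0.
rewrite mulrC ler_pdivlMr// -(@ler_pXn2r _ 2) ?nnegrE ?mulr_ge0// ?(ltW s0)//.
rewrite exprMn sqr_sqrtr ?(ltW a0)// mulrC.
have h1 := inner_le y (A x); have := sqr_ge0 (2 * `|A x| - `|y|).
by rewrite sqrrB; move: h h1; rewrite !expr2; nra.
Qed.

End inverse.

Lemma bop_tikhonov a A B : 0 < a -> compact_op A -> selfadjoint A ->
  bounded_op B -> bounded_op (tikhonov a A B).
Proof.
move=> a0 cA sA bB; apply: bop_comp; last exact: bop_adjoint.
by apply: bop_comp; [exact: bop_tikhonov_inverse|case: cA].
Qed.

(** Each factor [2] is one use of the quasi-triangle inequality. [C] and [W] bound [rho] and [w] in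
    operator norm, while [d0], [d1] and [M] are Schatten bounds, so every product has exactly one
    Schatten factor. *)
Lemma tikhonov_error p a A B R0 R1 rho w d0 d1 M C W :
  (1 <= p)%E -> 0 < a -> compact_op A -> selfadjoint A ->
  bounded_op B -> bounded_op R0 -> bounded_op R1 -> bounded_op rho ->
  bounded_op w ->
  adjoint R1 = R0 \o adjoint rho -> adjoint rho = R0 \o w ->
  0 <= d0 -> 0 <= d1 -> 0 <= M -> 0 < C -> 0 < W ->
  (forall x, `|rho x| <= C * `|x|) -> (forall x, `|w x| <= W * `|x|) ->
  schatten_bound p (A - R0) d0 -> schatten_bound p (B - R1) d1 ->
  schatten_bound p w M ->
  schatten_bound p (tikhonov a A B - adjoint rho)
    (2 * (2 * ((Num.sqrt a)^-1 * (2 * (d1 + C * d0)) + Num.sqrt a * M) + W *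
      d0)).
Proof.
move=> p1 a0 cA sA bB b0 b1 bR bw R1E rhoE d00 d10 M0 C0 W0 hC hW h0 h1 hM.
have bA := cA.1; have bR' := bop_adjoint bR; have bB' := bop_adjoint bB.
set Sinv := pinv setT (A \o A + a *: (idfun : H -> H)).
have bI : bounded_op Sinv by exact: bop_tikhonov_inverse.
have s0 : 0 < Num.sqrt a by rewrite sqrtr_gt0.
have bE0 : bounded_op (A - R0) by exact: bop_sub.
have bE1 : bounded_op (B - R1) by exact: bop_sub.
(* As [R1^* = R0 rho^*], this is [B^* - A rho^*], the residual of [rho^*] in the estimated
   equation. *)
pose D := adjoint (B - R1) - ((A - R0) \o adjoint rho).
have bD : bounded_op D.
  by apply: bop_sub; [exact: bop_adjoint|exact: bop_comp].
have bG : bounded_op (Sinv \o A) by exact: bop_comp.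
(* The two terms in [S^-1 A w] cancel, and what is subtracted from the estimator is
   [S^-1 (A A rho^* + a R0 w) = S^-1 S rho^*]. *)
have -> : tikhonov a A B - adjoint rho =
    ((Sinv \o A) \o D) - ((a *: (Sinv \o A)) \o w) +
    ((a *: Sinv) \o ((A - R0) \o w)).
  apply/funext => y.
  rewrite -[LHS]/(Sinv (A (adjoint B y)) - adjoint rho y).
  rewrite -[RHS]/(Sinv (A (D y)) - a *: Sinv (A (w y))
    + a *: Sinv (A (w y) - R0 (w y))).
  have rw : R0 (w y) = adjoint rho y by rewrite rhoE.
  have -> : D y = adjoint B y - A (adjoint rho y).
    rewrite -[LHS]/(adjoint (B - R1) y -
      (A (adjoint rho y) - R0 (adjoint rho y))).
    rewrite adjoint_sub// -[(adjoint B - _) y]/(adjoint B y - adjoint R1 y) R1E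
      /=.
    by rewrite opprB addrA subrK.
  rewrite rw (bopB bA) !(bopB bI) scalerBr addrA subrK -addrA -opprD.
  congr (_ - _).
  by rewrite -(bopZ bI) -(bopD bI); apply/esym; exact: tikhonov_inverseK.
have bnd1 : schatten_bound p D (2 * (d1 + C * d0)).
  apply: schatten_bound_add => //; first by rewrite mulr_ge0// ltW.
    exact: schatten_bound_adjoint.
  apply: schatten_bound_opp; [exact: bop_comp|by rewrite mulr_ge0// ltW|].
  by apply: schatten_bound_compr => //; apply: adjoint_bound => //; exact: ltW.
apply: schatten_bound_add => //.
- by rewrite mulr_ge0// addr_ge0// mulr_ge0// ?invr_ge0 ?(ltW s0)// mulr_ge0//
    addr_ge0// mulr_ge0// ltW.
- by rewrite mulr_ge0// ltW.
- apply: schatten_bound_add => //.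
  + by rewrite mulr_ge0// ?invr_ge0 ?(ltW s0)// mulr_ge0// addr_ge0//
      mulr_ge0// ltW.
  + by rewrite mulr_ge0// ltW.
  + apply: schatten_bound_compl => //; first by rewrite invr_gt0.
      by rewrite mulr_ge0// addr_ge0// mulr_ge0// ltW.
    by move=> x; exact: tikhonov_filter_le.
  + apply: schatten_bound_opp; [by apply: bop_comp => //;
      exact: bop_scale|by rewrite mulr_ge0// ltW|].
    apply: schatten_bound_compl => //; first exact: bop_scale.
    move=> x; rewrite -[(a *: _) x]/(a *: Sinv (A x)) normrZ gtr0_norm//.
    apply: le_trans (ler_wpM2l (ltW a0) (tikhonov_filter_le a0 cA sA x)) _.
    rewrite mulrA ler_wpM2r// -{1}(sqr_sqrtr (ltW a0)) expr2 mulfK// gt_eqF//.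
- rewrite -[W * d0]mul1r; apply: schatten_bound_compl => //.
  + exact: bop_comp.
  + exact: bop_scale.
  + by rewrite mulr_ge0// ltW.
  + move=> x; rewrite -[(a *: _) x]/(a *: Sinv x) normrZ gtr0_norm// mul1r.
    apply: le_trans (ler_wpM2l (ltW a0) (tikhonov_inverse_le a0 cA sA x)) _.
    by rewrite mulrA mulfV ?gt_eqF// mul1r.
  + exact: schatten_bound_compr.
Qed.

End tikhonov.

(** * Independence and square integrability *)

Section independence.
Context {d : measure_display} {T : measurableType d} {R : realType}
        (P : probability T R).

(* The joint law of [U] and [V] is the product of their laws; Fubini. *)
Lemma indep_integral_eq0 (U V : T -> R) :
  measurable_fun setT U -> measurable_fun setT V ->
  (forall A B : set R, measurable A -> measurable B ->
     P (U @^-1` A `&` V @^-1` B) = (P (U @^-1` A) * P (V @^-1` B))%E) ->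
  P.-integrable setT (EFin \o (U \* V)) ->
  P.-integrable setT (EFin \o V) ->
  (\int[P]_x (V x)%:E = 0)%E ->
  (\int[P]_x (U x * V x)%:E = 0)%E.
Proof.
move=> mU mV UV iUV iV V0.
have mW : measurable_fun setT (fun x => (U x, V x)).
  exact: measurable_fun_pair.
pose U' : {mfun T >-> R} := MeasurableFun.Pack
  (MeasurableFun.Class (isMeasurableFun.Build _ _ _ _ _ mU)).
pose V' : {mfun T >-> R} := MeasurableFun.Pack
  (MeasurableFun.Class (isMeasurableFun.Build _ _ _ _ _ mV)).
pose W' : {mfun T >-> (R * R)%type} := MeasurableFun.Pack
  (MeasurableFun.Class (isMeasurableFun.Build _ _ _ _ _ mW)).
pose m1 := distribution P U'; pose m2 := distribution P V'.
pose m := distribution P W'.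
have mE X : measurable X -> (m1 \x m2)%E X = m X.
  by move=> mX; apply: (@product_measure_unique _ _ _ _ _ m1 m2 m).
pose g (z : R * R) := (z.1 * z.2)%:E.
have mg : measurable_fun setT g.
  by apply/measurable_EFinP; apply: measurable_funM.
have ig : (m1 \x m2)%E.-integrable setT g.
  apply/integrableP; split => //.
  rewrite (@eq_measure_integral _ _ _ _ m); last by move=> X mX _; exact: mE.
  have /integrableP[_] : (pushforward P W').-integrable setT g.
    exact: integrable_pushforward.
  by [].
have -> : (\int[P]_x (U x * V x)%:E = \int[m]_z g z)%E.
  by rewrite integral_distribution.
rewrite (@eq_measure_integral _ _ _ _ (m1 \x m2)%E); last first.
  by move=> X mX _; exact/esym/mE.
rewrite -integral12_prod_meas1//.
(* Every section of the product has integral [x] times the mean of [V], which is zero. *)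
rewrite integral0_eq// => x _; rewrite /fubini_F /g/=.
rewrite (@integral_distribution _ _ _ _ _ P V' (fun y => (x * y)%:E))//=.
- under eq_integral do rewrite EFinM.
  by rewrite integralZl// V0 mule0.
- by apply/measurable_EFinP; apply: measurable_funM.
- rewrite (_ : _ \o _ = (fun y => x%:E * (V y)%:E)%E)//.
  exact: integrableZl.
Qed.

End independence.

Section square_integrable.
Context {d : measure_display} {T : measurableType d} {R : realType}
        (P : probability T R).

Definition sq_integrable (U : T -> R) :=
  measurable_fun setT U /\ P.-integrable setT (fun x => (U x ^+ 2)%:E).

Implicit Types U V : T -> R.

Lemma sq_integrable_mul U V : sq_integrable U -> sq_integrable V ->
  P.-integrable setT (EFin \o (U \* V)).
Proof.
move=> [mU iU] [mV iV].
apply: le_integrable (integrableD measurableT iU iV) => //.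
  by apply/measurable_EFinP; apply: measurable_funM.
move=> x _ /=.
rewrite lee_fin [leRHS]ger0_norm ?addr_ge0 ?sqr_ge0//.
rewrite normrM -(real_normK (num_real (U x))) -(real_normK (num_real (V x))).
have := sqr_ge0 (`|U x| - `|V x|); have := normr_ge0 (U x).
by have := normr_ge0 (V x); rewrite sqrrB; nra.
Qed.

Lemma sq_integrable_lty U : measurable_fun setT U ->
  (\int[P]_x (U x ^+ 2)%:E < +oo)%E -> sq_integrable U.
Proof.
move=> mU h; split=> //; apply/integrableP; split.
  by apply/measurable_EFinP; apply: measurable_funX.
by under eq_integral do rewrite gee0_abs ?lee_fin ?sqr_ge0//.
Qed.

Lemma sq_integrable_le U V : sq_integrable V -> measurable_fun setT U ->
  (forall x, `|U x| <= `|V x|) -> sq_integrable U.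
Proof.
move=> [mV iV] mU h; split=> //; apply: le_integrable iV => //.
  by apply/measurable_EFinP; apply: measurable_funX.
move=> x _; rewrite lee_fin !normrX ler_pXn2r ?nnegrE//.
Qed.

Lemma sq_integrable_cst (c : R) : sq_integrable (cst c).
Proof.
split=> //; exact: (@finite_measure_integrable_cst _ _ _ P setT (c ^+ 2)).
Qed.

Lemma sq_integrable_integrable U : sq_integrable U ->
  P.-integrable setT (EFin \o U).
Proof.
move=> hU; have := sq_integrable_mul hU (sq_integrable_cst 1).
by apply: eq_integrable => // x _ /=; rewrite mulr1.
Qed.

Lemma sq_integrableD U V : sq_integrable U -> sq_integrable V ->
  sq_integrable (U \+ V).
Proof.
move=> hU hV; have iUV := sq_integrable_mul hU hV.
have [mU iU] := hU; have [mV iV] := hV.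
split; first exact: measurable_funD.
have := integrableD measurableT (integrableD measurableT iU iV)
  (integrableZl measurableT 2 iUV).
apply: eq_integrable => // x _ /=; rewrite -EFinM -!EFinD; congr EFin.
by ring.
Qed.

Lemma sq_integrableZ (c : R) U : sq_integrable U ->
  sq_integrable (fun x => c * U x).
Proof.
move=> [mU iU]; split; first exact: measurable_funM.
have := integrableZl measurableT (c ^+ 2) iU.
by apply: eq_integrable => // x _ /=; rewrite exprMn EFinM.
Qed.

End square_integrable.

(** * Autocovariance of the ARH(1) process *)

Section random_elements.
Context {d : measure_display} {T : measurableType d} {R : realType}
        (P : probability T R) {H : hilbertType R}.
Implicit Types (X Y Z : T -> H) (u v f g : H).

Lemma measurable_comp_continuous Y (phi : H -> R) : random_element Y ->
  continuous phi -> measurable_fun setT (phi \o Y).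
Proof.
move=> mY cphi; apply: (measurability _ (RGenOpens.measurableE R)).
move=> _ [_ [a [b ->] <-]].
suff /(mY measurableT) : measurable (phi @^-1` `]a, b[%classic : set (borel H))
  by [].
apply: sub_sigma_algebra.
by apply: open_comp => [x _|]; [exact: cphi|exact: interval_open].
Qed.

Definition L2 Y :=
  random_element Y /\ ('E_P[fun w => (`|Y w| ^+ 2)%R] < +oo)%E.

Lemma L2_norm Y : L2 Y -> sq_integrable P (fun w => `|Y w|).
Proof.
move=> [mY +]; rewrite unlock => hY; apply: sq_integrable_lty => //.
by apply: measurable_comp_continuous mY _ => x; exact: norm_continuous.
Qed.

Lemma measurable_inner Y v : random_element Y ->
  measurable_fun setT (fun w => inner (Y w) v).
Proof.
move=> mY; apply: (measurable_comp_continuous (phi := fun x => inner x v) mY).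
exact: inner_continuousl.
Qed.

Lemma L2_inner Y v : L2 Y -> sq_integrable P (fun w => inner (Y w) v).
Proof.
move=> hY; apply: (sq_integrable_le (sq_integrableZ `|v| (L2_norm hY))).
  by apply: measurable_inner; case: hY.
move=> w; apply: le_trans (cauchy_schwarz _ _) _.
by rewrite mulrC ler_norm.
Qed.

Lemma expectation_Rintegral (U : T -> R) : P.-integrable setT (EFin \o U) ->
  'E_P[U]%E = (\int[P]_w U w)%:E.
Proof. by move=> iU; rewrite unlock fineK//; exact: integrable_fin_num. Qed.

Section cross_covariance.
Variables Y Z : T -> H.
Hypotheses (hY : L2 Y) (hZ : L2 Z).

Definition crosscov_form f v := \int[P]_w (inner (Z w) f * inner (Y w) v).

Let intF f v : P.-integrable setT
  (EFin \o (fun w => inner (Z w) f * inner (Y w) v)).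
Proof. exact: sq_integrable_mul (L2_inner f hZ) (L2_inner v hY). Qed.

Let intN : P.-integrable setT (EFin \o (fun w => `|Z w| * `|Y w|)).
Proof. exact: sq_integrable_mul (L2_norm hZ) (L2_norm hY). Qed.

Let K := \int[P]_w (`|Z w| * `|Y w|).

Let crosscov_form_le f v : `|crosscov_form f v| <= K * `|f| * `|v|.
Proof.
apply: le_trans (le_normr_Rintegral measurableT (intF f v)) _.
rewrite -mulrA mulrC -RintegralZl//; apply: le_Rintegral => //.
- have := integrable_norm (intF f v).
  by apply: eq_integrable.
- have := integrableZl measurableT (`|f| * `|v|) intN.
  by apply: eq_integrable => // w _ /=; rewrite EFinM.
- move=> w _; rewrite normrM.
  rewrite [leRHS](_ : _ = (`|Z w| * `|f|) * (`|Y w| * `|v|)); last by ring.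
  by rewrite ler_pM// cauchy_schwarz.
Qed.

Let crosscov_formDr f a u v :
  crosscov_form f (a *: u + v) = a * crosscov_form f u + crosscov_form f v.
Proof.
rewrite /crosscov_form -RintegralZl// -RintegralD//.
  by apply: eq_Rintegral => w _; rewrite innerDr innerZr; ring.
have := integrableZl measurableT a (intF f u).
by apply: eq_integrable => // w _ /=; rewrite EFinM.
Qed.

Let crosscov_formDl v a f g :
  crosscov_form (a *: f + g) v = a * crosscov_form f v + crosscov_form g v.
Proof.
rewrite /crosscov_form -RintegralZl// -RintegralD//.
  by apply: eq_Rintegral => w _; rewrite innerDr innerZr; ring.
have := integrableZl measurableT a (intF f v).
by apply: eq_integrable => // w _ /=; rewrite EFinM.
Qed.

(** [mean] is a choice, so a mean must be exhibited: the Riesz representative of [crosscov_form f],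
    a functional bounded by [K * |f|] with [K] the expectation of [|Z| |Y|]. *)
Lemma inner_crosscov f v : inner (crosscov P Y Z f) v = crosscov_form f v.
Proof.
have E u : 'E_P[fun w => inner (tensor (Y w) (Z w) f) u]%E = (crosscov_form f
  u)%:E.
  rewrite -expectation_Rintegral//; congr expectation.
  by apply/funext => w; rewrite innerZl innerC.
have [z hz] : exists z, forall u, crosscov_form f u = inner u z.
  apply: (@riesz R H _ (K * `|f|)) => [a u u' /=|u];
    first exact: crosscov_formDr.
  exact: crosscov_form_le.
have /getPex[_ /(_ v)] : exists m, is_mean P (fun w => tensor (Y w) (Z w) f) m.
  exists z; split; last by move=> u; rewrite E hz innerC.
  have hf : sq_integrable P (fun w => `|inner (Z w) f|).
    apply: (sq_integrable_le (L2_inner f hZ)) => [|w]; last by rewrite normr_id.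
    apply: measurableT_comp => //; apply: measurable_inner; by case: hZ.
  have := sq_integrable_mul hf (L2_norm hY).
  by apply: eq_integrable => // w _ /=; rewrite normrZ innerC.
by rewrite E => -[].
Qed.

Lemma bop_crosscov : bounded_op (crosscov P Y Z).
Proof.
apply: (@linear_bounded_op R H _ K) => [a f g|f].
  apply: inner_inj => v.
  by rewrite innerDl innerZl !inner_crosscov crosscov_formDl.
apply: norm_le_inner => [|v].
  by rewrite mulr_ge0// Rintegral_ge0// => w _; rewrite mulr_ge0.
rewrite inner_crosscov; apply: le_trans (ler_norm _) _.
exact: crosscov_form_le.
Qed.

End cross_covariance.

Lemma sq_integrable_ae (U V : T -> R) : measurable_fun setT U ->
  {ae P, forall w, U w = V w} -> sq_integrable P V -> sq_integrable P U.
Proof.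
move=> mU UV [mV iV]; apply: sq_integrable_lty => //.
rewrite (@ge0_ae_eq_integral _ _ _ P setT _ (fun w => (V w ^+ 2)%:E))//.
- have /integrableP[_] := iV.
  have -> // : (\int[P]_w `|(V w ^+ 2)%:E| = \int[P]_w (V w ^+ 2)%:E)%E.
  by apply: eq_integral => w _; rewrite gee0_abs// lee_fin sqr_ge0.
- by apply/measurable_EFinP; apply: measurable_funX.
- by apply/measurable_EFinP; apply: measurable_funX.
- by move=> w _; rewrite lee_fin sqr_ge0.
- by move=> w _; rewrite lee_fin sqr_ge0.
- by apply: filterS UV => w -> _.
Qed.

Lemma Rintegral_ae (U V : T -> R) : measurable_fun setT U ->
  measurable_fun setT V -> {ae P, forall w, U w = V w} ->
  \int[P]_w U w = \int[P]_w V w.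
Proof.
move=> mU mV UV; congr fine; apply: ae_eq_integral => //.
- exact/measurable_EFinP.
- exact/measurable_EFinP.
- by apply: filterS UV => w -> _.
Qed.

End random_elements.

(** * The noise is uncorrelated with the past of the process *)

Section arh.
Context {d : measure_display} {T : measurableType d} {R : realType}
        (P : probability T R) {H : hilbertType R}.
Variables (rho : H -> H) (eps X : int -> T -> H).
Hypothesis hX : ARH1 P rho eps X.
Implicit Types (u v f g : H) (s t : int).

Let bR : bounded_op rho := arh_rho hX.

Lemma arh_L2 t : L2 P (X t).
Proof. by split; [exact: arh_random hX t|exact: arh_square hX t]. Qed.

Lemma arh_inner t u : {ae P, forall w,
  inner (X t w) u = inner (X (t - 1) w) (adjoint rho u) + inner (eps t w) u}.
Proof.
by apply: filterS (arh_eq hX t) => w ->; rewrite innerDl adjointP.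
Qed.

(** Read off from the recursion: almost surely this is [<X_t, u> - <X_(t-1), rho^* u>]. *)
Lemma noise_sq_integrable t u : sq_integrable P (fun w => inner (eps t w) u).
Proof.
apply: (sq_integrable_ae (V := fun w => inner (X t w) u +
    (-1) * inner (X (t - 1) w) (adjoint rho u))).
- have mr : random_element (eps t) := wn_random (arh_noise hX) t.
  exact: measurable_inner.
- by apply: filterS (arh_inner t u) => w ->; ring.
- by apply: sq_integrableD; [|apply: sq_integrableZ]; apply: L2_inner;
    exact: arh_L2.
Qed.

(** Independence passes to inner products, since preimages of Borel sets under [inner^~ u] are Borel
    in [H]; the factor at time [t] has mean zero. *)
Lemma noise_uncorrelated s t u v : s != t ->
  \int[P]_w (inner (eps s w) u * inner (eps t w) v) = 0.
Proof.
move=> st; rewrite /Rintegral.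
have wn := arh_noise hX.
have mi r z : measurable_fun setT (fun w => inner (eps r w) z).
  have mr : random_element (eps r) := wn_random wn r.
  exact: measurable_inner.
rewrite (@indep_integral_eq0 _ _ _ P (fun w => inner (eps s w) u)
  (fun w => inner (eps t w) v))//.
- move=> A B mA mB.
  have mpre r z (C : set R) : measurable C ->
      measurable ((fun x : H => inner x z) @^-1` C : set (borel H)).
    move=> mC; rewrite -[X in measurable X]setTI.
    have : measurable_fun setT ((fun x : H => inner x z) : borel H -> R).
      by apply: (@measurable_inner _ (borel H) R H (fun x : borel H => x : H))
        => _ S mS; rewrite setTI.
    by move=> /(_ measurableT C mC).
  have := wn_indep wn (J := [:: s; t]) (B := fun r => if r == s
    then (fun x : H => inner x u) @^-1` A else (fun x : H => inner x v) @^-1`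
      B).
  rewrite /= inE st => /(_ isT)/(_ _)/wrap[r|].
    by case: ifP => _; exact: mpre.
  rewrite big_cons big_seq1 eqxx eq_sym (negbTE st) => <-.
  congr (P _); apply/seteqP; split => w /=.
    move=> [hA hB] r /=; rewrite !inE => /orP[/eqP ->|/eqP ->].
      by rewrite eqxx.
    by rewrite eq_sym (negbTE st).
  move=> h; split.
    by have := h s; rewrite /= !inE eqxx => /(_ isT).
  by have := h t; rewrite /= !inE eqxx orbT eq_sym (negbTE st) => /(_ isT).
- exact: sq_integrable_mul (noise_sq_integrable s u) (noise_sq_integrable t v).
- exact: sq_integrable_integrable (noise_sq_integrable t v).
- by have [_ /(_ v)] := wn_mean wn t; rewrite unlock inner0l.
Qed.

Let pair s u v := \int[P]_w (inner (X s w) u * inner (eps 1 w) v).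

Let pair_int s u v : P.-integrable setT
  (EFin \o (fun w => inner (X s w) u * inner (eps 1 w) v)).
Proof.
exact: sq_integrable_mul (L2_inner u (arh_L2 s)) (noise_sq_integrable 1 v).
Qed.

(** The recursion at time [s] adds only the covariance of [eps s] with [eps 1], which vanishes for
    [s != 1]. *)
Let pair_step s u v : s != 1 -> pair s u v = pair (s - 1) (adjoint rho u) v.
Proof.
move=> s1; rewrite /pair.
have ms t z : measurable_fun setT (fun w => inner (eps t w) z).
  by case: (noise_sq_integrable t z).
have mX t z : measurable_fun setT (fun w => inner (X t w) z).
  by case: (L2_inner z (arh_L2 t)).
rewrite (@Rintegral_ae _ _ _ _ _ (fun w =>
  inner (X (s - 1) w) (adjoint rho u) * inner (eps 1 w) v +
  inner (eps s w) u * inner (eps 1 w) v)).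
- have j2 := sq_integrable_mul (noise_sq_integrable s u) (noise_sq_integrable 1
    v).
  rewrite (RintegralD measurableT (pair_int (s - 1) (adjoint rho u) v) j2).
  by rewrite noise_uncorrelated// addr0.
- exact: measurable_funM.
- by apply: measurable_funD; apply: measurable_funM.
- by apply: filterS (arh_inner s u) => w ->; rewrite mulrDl.
Qed.

Let pair_iter k u v : pair 0 u v = pair (- k%:Z) (iter k (adjoint rho) u) v.
Proof.
elim: k => [|k IH]; first by rewrite oppr0.
rewrite IH pair_step; last by rewrite lt_eqF// (le_lt_trans _ ltr01)// oppr_le0.
by have -> : - k.+1%:Z = - k%:Z - 1 by rewrite -addn1 PoszD opprD.
Qed.

(** Otherwise every term of the convergent series of [opnorm (rho^j) ^+ 2] would be at least
    [delta], and [n * delta] would stay below its sum for all [n]. *)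
Lemma iter_small (delta : R) : 0 < delta -> exists k, exists c,
  [/\ 0 <= c, c ^+ 2 <= delta & forall x, `|iter k rho x| <= c * `|x|].
Proof.
move=> d0.
have bk k : bounded_op (iter k rho).
  by elim: k => [|k IH]; [exact: bop_id|exact: (bop_comp bR IH)].
have fk k : exists2 c, 0 <= c & opnorm (iter k rho) = c%:E.
  have [C C0 hC] := bop_bounded (bk k).
  have := (opnorm_leP (bk k) (ltW C0)).2 hC.
  have := schatten_ge0 +oo%E (bk k); rewrite /=.
  by case: (opnorm _) => [c| |]// c0 _; exists c.
have /choice[q hq] k : exists c, 0 <= c /\ opnorm (iter k rho) = c%:E.
  by have [c c0 hc] := fk k; exists c.
apply: contrapT => hn.
have big k : delta <= q k ^+ 2.
  rewrite leNgt; apply/negP => h; apply: hn; exists k, (q k); split.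
  - by case: (hq k).
  - exact: ltW.
  - by apply/opnorm_leP => //; [case: (hq k)|case: (hq k) => _ ->].
have := arh_summable hX.
set S := (\sum_(_ <= _ <oo) _)%E.
have hS n : ((n%:R * delta)%:E <= S)%E.
  apply: (@le_trans _ _ (\sum_(0 <= j < n) opnorm (iter j rho) ^+ 2)%E).
    rewrite (eq_bigr (fun j => (q j ^+ 2)%:E)); last first.
      by move=> j _; rewrite (hq j).2 -EFin_expe.
    rewrite sumEFin lee_fin.
    apply: (@le_trans _ _ (\sum_(0 <= j < n) delta)).
      by rewrite sumr_const_nat subn0 mulr_natl.
    exact: ler_sum.
  apply: nneseries_lim_ge => k _ _.
  by rewrite (hq k).2 -EFin_expe lee_fin sqr_ge0.
case: S hS => [s hS _| hS //|hS _]; last by have := hS 0%N.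
have := hS (Num.bound (s / delta)); rewrite lee_fin.
rewrite leNgt -ltr_pdivrMr// => /negP; apply.
by rewrite archi_boundP// divr_ge0 ?(ltW d0)//; have := hS 0%N;
  rewrite mul0r lee_fin.
Qed.

(* The AR(1) recursion run backwards: only [rho^k X_{-k}] remains, and it
   vanishes in mean square by stationarity. *)
Lemma noise_past_uncorrelated u v : pair 0 u v = 0.
Proof.
pose m := \int[P]_w (`|X 0 w| ^+ 2).
pose b := \int[P]_w (inner (eps 1 w) v ^+ 2).
apply/eqP; rewrite -normr_le0.
apply: (@le0_of_le_eps _ _ ((`|u| ^+ 2 * m + b) / 2)) => e e0.
(* With [2 |A B| <= A^2 / e + e B^2] in view, [c^2 <= e^2] compensates the factor [1 / e] and leaves
   a bound linear in [e]. *)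
have [k [c [c0 ce hc]]] := iter_small (exprn_gt0 2 e0).
pose y := iter k (adjoint rho) u.
have ny : `|y| <= c * `|u|.
  have adj_iter n x : inner x (iter n (adjoint rho) u) = inner (iter n rho x) u.
    elim: n x => [//|n IH] x.
    by rewrite iterS -adjointP// IH -iterSr.
  apply: norm_le_inner => [|x]; first by rewrite mulr_ge0.
  rewrite innerC adj_iter; apply: le_trans (inner_le _ _) _.
  by rewrite mulrAC ler_wpM2r.
have sX t z := L2_inner z (arh_L2 t).
have se := noise_sq_integrable 1 v.
have i1 : P.-integrable setT (EFin \o (fun w => e^-1 * inner (X (- k%:Z) w) y
  ^+ 2)).
  have := integrableZl measurableT e^-1 (sX (- k%:Z) y).2.
  by apply: eq_integrable => // w _ /=; rewrite EFinM.
have i2 : P.-integrable setT (EFin \o (fun w => e * inner (eps 1 w) v ^+ 2)).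
  have := integrableZl measurableT e se.2.
  by apply: eq_integrable => // w _ /=; rewrite EFinM.
have i3 : P.-integrable setT (EFin \o (fun w =>
    e^-1 * inner (X (- k%:Z) w) y ^+ 2 + e * inner (eps 1 w) v ^+ 2)).
  have := integrableD measurableT i1 i2.
  by apply: eq_integrable => // w _ /=; rewrite EFinD.
have h1 : 2 * `|pair 0 u v| <= e^-1 * \int[P]_w (inner (X (- k%:Z) w) y ^+ 2) +
  e * b.
  rewrite (pair_iter k) -!RintegralZl//; [|exact: se.2|exact: (sX _ _).2].
  rewrite -RintegralD//.
  apply: (@le_trans _ _ (2 * \int[P]_w `|inner (X (- k%:Z) w) y * inner (eps 1
    w) v|)).
    by rewrite ler_wpM2l//; exact: le_normr_Rintegral.
  have i4 := integrable_norm (pair_int (- k%:Z) y v).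
  rewrite -RintegralZl//; apply: le_Rintegral => //.
    have := integrableZl measurableT 2 i4.
    by apply: eq_integrable => // w _ /=; rewrite EFinM.
  move=> w _; set A := inner _ y; set B := inner _ v.
  rewrite normrM -(real_normK (num_real A)) -(real_normK (num_real B)).
  rewrite -subr_ge0.
  rewrite [X in 0 <= X](_ : _ = e^-1 * (`|A| - e * `|B|) ^+ 2).
    by rewrite mulr_ge0 ?sqr_ge0// invr_ge0 ltW.
  by field; rewrite gt_eqF.
have h2 : \int[P]_w (inner (X (- k%:Z) w) y ^+ 2) = \int[P]_w (inner (X 0 w) y
  ^+ 2).
  have := arh_stationary hX (- k%:Z) (- k%:Z) k y y; rewrite addNr.
  by rewrite unlock /Rintegral => ->.
have h3 : \int[P]_w (inner (X 0 w) y ^+ 2) <= `|y| ^+ 2 * m.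
  rewrite -RintegralZl//; last exact: (L2_norm (arh_L2 0)).2.
  apply: le_Rintegral => //; first exact: (sX 0 y).2.
    have := integrableZl measurableT (`|y| ^+ 2) (L2_norm (arh_L2 0)).2.
    by apply: eq_integrable => // w _ /=; rewrite EFinM.
  move=> w _; rewrite -exprMn -(real_normK (num_real (inner _ y))).
  by rewrite ler_pXn2r ?nnegrE ?mulr_ge0// mulrC cauchy_schwarz.
have m0 : 0 <= m by apply: Rintegral_ge0 => w _; exact: sqr_ge0.
have h4 : `|y| ^+ 2 * m <= e ^+ 2 * (`|u| ^+ 2 * m).
  rewrite mulrA ler_wpM2r//; apply: (@le_trans _ _ ((c * `|u|) ^+ 2)).
    by rewrite ler_pXn2r ?nnegrE ?mulr_ge0.
  by rewrite exprMn ler_wpM2r ?sqr_ge0.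
have h5 : e^-1 * \int[P]_w (inner (X (- k%:Z) w) y ^+ 2) <= e * (`|u| ^+ 2 * m).
  rewrite h2 mulrC ler_pdivrMr//; apply: le_trans h3 (le_trans h4 _).
  by rewrite le_eqVlt; apply/orP; left; apply/eqP; ring.
move: h1 h5; lra.
Qed.

Lemma adjoint_autocov1 :
  adjoint (autocov P X 1) = autocov P X 0 \o adjoint rho.
Proof.
apply: adjoint_unique => f v /=.
rewrite [RHS]innerC !inner_crosscov; try exact: arh_L2.
rewrite /crosscov_form.
have sX t z := L2_inner z (arh_L2 t).
have se := noise_sq_integrable 1 v.
rewrite (@Rintegral_ae _ _ _ _ _ (fun w =>
  inner (X 0 w) (adjoint rho v) * inner (X 0 w) f +
  inner (X 0 w) f * inner (eps 1 w) v)).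
- have j1 := sq_integrable_mul (sX 0 (adjoint rho v)) (sX 0 f).
  rewrite (RintegralD measurableT j1 (pair_int 0 f v)).
  by rewrite -/(pair 0 f v) noise_past_uncorrelated addr0.
- by apply: measurable_funM; [case: (sX 0 f)|case: (sX 1 v)].
- apply: measurable_funD; apply: measurable_funM;
    try by [case: (sX 0 f)|case: (sX 0 (adjoint rho v))|case: se].
- apply: filterS (arh_inner 1 v) => w ->; rewrite subrr; ring.
Qed.

End arh.

(** * Rates in probability *)

Section stochastic_order.
Context {d : measure_display} {T : measurableType d} {R : realType}
        (P : probability T R).
Implicit Types (Z : nat -> T -> \bar R) (a b : nat -> R).

(** The constant may depend on [e], so replacing a limsup by an eventual bound only costs halving
    [e]. *)
Lemma bigO_PP Z a : bigO_P P Z a <-> forall e, 0 < e -> exists C,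
  \forall n \near \oo, (mu_ext P [set w | ((C * a n)%:E < Z n w)%E] <= e%:E)%E.
Proof.
split=> h e e0.
  have /h[C hC] : 0 < e / 2 by rewrite divr_gt0.
  exists C; have : (limn_esup (fun n => mu_ext P [set w | ((C * a n)%:E < Z n
    w)%E])
      < e%:E)%E by apply: le_lt_trans hC _; rewrite lte_fin; lra.
  move=> /ereal_inf_lt[_ [V nV <-] hV]; apply: filterS nV => n Vn.
  by apply: le_trans (ltW hV); apply: ereal_sup_ubound; exists n.
have [C hC] := h e e0; exists C.
apply: le_trans (ereal_inf_lbound _) _; first by eexists;
  [exact: hC|reflexivity].
by apply: ge_ereal_sup => _ [n hn <-].
Qed.

(** The exceptional set of [Z] lies in the union of those of [Z0] and [Z1], each of outer measure at
    most [e / 2]. This reduces a rate in probability to a deterministic implication. *)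
Lemma bigO_P_transfer Z0 Z1 Z a b : (forall n, 0 < a n) ->
  bigO_P P Z0 a -> bigO_P P Z1 a ->
  (forall C, 0 <= C -> exists K, \forall n \near \oo, forall w,
    (Z0 n w <= (C * a n)%:E)%E -> (Z1 n w <= (C * a n)%:E)%E ->
    (Z n w <= (K * b n)%:E)%E) ->
  bigO_P P Z b.
Proof.
move=> a0 /bigO_PP h0 /bigO_PP h1 h; apply/bigO_PP => e e0.
have e2 : 0 < e / 2 by rewrite divr_gt0.
have [C0 hC0] := h0 _ e2; have [C1 hC1] := h1 _ e2.
(* One nonnegative constant above both [C0] and [C1], whose signs are unknown. *)
have [K hK] := h (`|C0| + `|C1|) (addr_ge0 (normr_ge0 _) (normr_ge0 _)).
exists K; move: hC0 hC1 hK; apply: filterS3 => n {}h0 {}h1 hK.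
apply: (@le_trans _ _ (mu_ext P ([set w | ((C0 * a n)%:E < Z0 n w)%E] `|`
    [set w | ((C1 * a n)%:E < Z1 n w)%E]))).
  apply: le_mu_ext => w /= KZ; apply: contrapT => /not_orP[/negP + /negP].
  rewrite -!leNgt => l0 l1.
  have lC c : c <= `|C0| + `|C1| -> ((c * a n)%:E <= ((`|C0| + `|C1|) * a
    n)%:E)%E.
    by move=> cC; rewrite lee_fin ler_pM2r.
  move: KZ; apply/negP; rewrite -leNgt; apply: hK.
    by apply: le_trans l0 (lC _ _); rewrite ler_wpDr ?ler_norm.
  by apply: le_trans l1 (lC _ _); rewrite ler_wpDl ?ler_norm.
apply: le_trans (outer_measureU2 _ _ _) _.
by rewrite [e]splitr EFinD leeD.
Qed.

End stochastic_order.

(** For [a <= 1] both [g / a] and [g] are at most [g / a^3]; for [a > 1] they are at most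
    [g <= 1 < a]. The factor [3] comes from squaring a sum of three terms. *)
Lemma rate_bound {R : realType} (C A1 A2 A3 g a : R) :
  0 <= C -> 0 < g -> g <= 1 -> 0 < a ->
  (A1 * (Num.sqrt (C * g) / Num.sqrt a) + A2 * Num.sqrt a +
    A3 * Num.sqrt (C * g)) ^+ 2 <=
  3 * (A1 ^+ 2 * C + A2 ^+ 2 + A3 ^+ 2 * C) * (g / a ^+ 3 + a).
Proof.
move=> C0 g0 g1 a0; set x := A1 * _; set y := A2 * _; set z := A3 * _.
have h3 : (x + y + z) ^+ 2 <= 3 * (x ^+ 2 + y ^+ 2 + z ^+ 2).
  have := sqr_ge0 (x - y); have := sqr_ge0 (y - z); have := sqr_ge0 (x - z).
  by rewrite !expr2; nra.
apply: le_trans h3 _; rewrite -mulrA ler_wpM2l//.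
have sg : Num.sqrt (C * g) ^+ 2 = C * g by rewrite sqr_sqrtr// mulr_ge0// ltW.
have sa : Num.sqrt a ^+ 2 = a by rewrite sqr_sqrtr// ltW.
have -> : x ^+ 2 = A1 ^+ 2 * C * (g / a).
  by rewrite /x exprMn expr_div_n sg sa; ring.
have -> : y ^+ 2 = A2 ^+ 2 * a by rewrite /y exprMn sa.
have -> : z ^+ 2 = A3 ^+ 2 * C * g by rewrite /z exprMn sg mulrA.
have ga3 : 0 <= g / a ^+ 3 by rewrite divr_ge0 ?exprn_ge0// ltW.
have k1 : 0 <= A1 ^+ 2 * C by rewrite mulr_ge0 ?sqr_ge0.
have k2 : 0 <= A2 ^+ 2 by exact: sqr_ge0.
have k3 : 0 <= A3 ^+ 2 * C by rewrite mulr_ge0 ?sqr_ge0.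
have h0 : a <= g / a ^+ 3 + a by rewrite lerDr.
have [a1|a1] := leP a 1.
  have h1 : g / a <= g / a ^+ 3 + a.
    apply: (@le_trans _ _ (g / a ^+ 3)); last by rewrite lerDl ltW.
    rewrite ler_pM2l// lef_pV2 ?posrE ?exprn_gt0//.
    by rewrite -{2}[a]expr1 ler_wiXn2l// ltW.
  have h2 : g <= g / a ^+ 3 + a.
    apply: (@le_trans _ _ (g / a ^+ 3)); last by rewrite lerDl ltW.
    by rewrite ler_pdivlMr ?exprn_gt0// ler_piMr ?(ltW g0)// exprn_ile1// ltW.
  by rewrite !mulrDl !lerD// ler_wpM2l.
have h2 : g <= g / a ^+ 3 + a.
  by apply: le_trans g1 _; rewrite ler_wpDl// ltW.
have h1 : g / a <= g / a ^+ 3 + a.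
  by apply: le_trans h2; rewrite ler_pdivrMr// ler_peMr ?ltW.
by rewrite !mulrDl !lerD// ler_wpM2l.
Qed.

(** With [b] the fourth root of [g], the hypothesis puts [a] between [b / 2] and [3 b / 2], so the
    sum is at most [8 b + 3 b / 2 <= 10 b]. *)
Lemma optimal_rate {R : realType} (g a : R) : 0 < g -> 0 < a ->
  `|1 - a / g `^ (1 / 4)| < 1 / 2 ->
  g / a ^+ 3 + a <= 10 * g `^ (1 / 4).
Proof.
move=> g0 a0; set b := g `^ _; have b0 : 0 < b by exact: powR_gt0.
have -> : g = b ^+ 4.
  by rewrite -powR_mulrn ?ltW// -powRrM -mulrA mulVf// mulr1 powRr1// ltW.
rewrite ltr_norml => /andP[h1 h2].
have ha1 : b / 2 <= a.
  have : 1 / 2 < a / b by lra.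
  by rewrite ltr_pdivlMr// => /ltW; lra.
have ha2 : a <= 3 / 2 * b.
  have : a / b < 3 / 2 by lra.
  by rewrite ltr_pdivrMr// => /ltW.
have : b ^+ 4 / a ^+ 3 <= 8 * b.
  rewrite ler_pdivrMr ?exprn_gt0//.
  have -> : b ^+ 4 = 8 * b * (b / 2) ^+ 3 by field.
  rewrite ler_wpM2l ?mulr_ge0 ?(ltW b0)// ler_pXn2r ?nnegrE ?(ltW a0)//.
  by rewrite divr_ge0// ltW.
lra.
Qed.

Lemma lee_sqr_sqrt {R : realType} (x : \bar R) (c : R) : (0 <= x)%E ->
  (x ^+ 2 <= c%:E)%E -> (x <= (Num.sqrt c)%:E)%E.
Proof.
case: x => [r| |]//.
rewrite -EFin_expe !lee_fin => r0 h.
by rewrite -(ger0_norm r0) -sqrtr_sqr ler_wsqrtr.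
Qed.

Lemma lee_sqr {R : realType} (x : \bar R) (c : R) : (0 <= x)%E -> 0 <= c ->
  (x <= c%:E)%E -> (x ^+ 2 <= (c ^+ 2)%:E)%E.
Proof.
case: x => [r| |]//.
by rewrite -EFin_expe !lee_fin => r0 c0 h; rewrite ler_pXn2r ?nnegrE.
Qed.

Theorem theorem1
  (R : realType) (H : hilbertType R) (Hsep : separable H)
  (d : measure_display) (T : measurableType d) (P : probability T R)
  (rho : H -> H) (eps X : int -> T -> H)
  (hX : ARH1 P rho eps X)
  (R0 R1 : H -> H)
  (R0_def : R0 = autocov P X 0) (R1_def : R1 = autocov P X 1)
  (rho_HS : schatten_class 2%:E rho)
  (R0_ker : [set x | R0 x = 0] = [set 0])
  (p : \bar R) (p_ge1 : (1 <= p)%E)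
  (w : H -> H) (M : R) (w_bounded : bounded_op w) (M_gt0 : 0 < M)
  (source : adjoint R1 = R0 \o R0 \o w)
  (w_le : (schatten p w <= M%:E)%E)
  (R0h R1h : nat -> T -> H -> H)
  (R0h_random : forall n, random_operator (R0h n))
  (R1h_random : forall n, random_operator (R1h n))
  (R0h_self : forall n o, selfadjoint (R0h n o))
  (R0h_class : forall n o, schatten_class p (R0h n o))
  (R1h_HS : forall n o, schatten_class 2%:E (R1h n o))
  (gamma : nat -> R) (gamma_gt0 : forall n, 0 < gamma n)
  (gamma_cvg0 : gamma @ \oo --> (0 : R))
  (R0h_rate : bigO_P P (fun n o => (schatten p (R0h n o - R0) ^+ 2)%E) gamma)
  (R1h_rate : bigO_P P (fun n o => (schatten p (R1h n o - R1) ^+ 2)%E) gamma)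
  (alpha : nat -> R) (alpha_gt0 : forall n, 0 < alpha n)
  (Phi : nat -> T -> H -> H)
  (Phi_def : forall n o, Phi n o = tikhonov (alpha n) (R0h n o) (R1h n o)) :
  [/\ forall n o, (schatten p (Phi n o - adjoint rho) ^+ 2)%E =
                  (schatten p (adjoint (Phi n o) - rho) ^+ 2)%E,
      bigO_P P (fun n o => (schatten p (Phi n o - adjoint rho) ^+ 2)%E)
        (fun n => gamma n / alpha n ^+ 3 + alpha n)
    & (fun n => alpha n / gamma n `^ (1 / 4)) @ \oo --> (1 : R) ->
      bigO_P P (fun n o => (schatten p (Phi n o - adjoint rho) ^+ 2)%E)
        (fun n => gamma n `^ (1 / 4))].
Proof.
have bR := arh_rho hX; have bR' := bop_adjoint bR.
have b0 : bounded_op R0 by rewrite R0_def; apply: bop_crosscov;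
  exact: (arh_L2 hX).
have b1 : bounded_op R1 by rewrite R1_def; apply: bop_crosscov;
  exact: (arh_L2 hX).
have bA n o : bounded_op (R0h n o) by have [[]] := R0h_class n o.
have bB n o : bounded_op (R1h n o) by have [[]] := R1h_HS n o.
have bPhi n o : bounded_op (Phi n o).
  by rewrite Phi_def; apply: bop_tikhonov => //; case: (R0h_class n o).
have bD n o : bounded_op (Phi n o - adjoint rho) by exact: bop_sub.
have R1E : adjoint R1 = R0 \o adjoint rho.
  by rewrite R1_def R0_def; exact: (adjoint_autocov1 hX).
(* [R0 rho^*] and [R0 R0 w] both equal [R1^*]; the trivial kernel cancels one [R0]. *)
have rhoE : adjoint rho = R0 \o w.
  apply/funext => x; apply/eqP; rewrite -subr_eq0; apply/eqP.
  have : [set x | R0 x = 0] (adjoint rho x - R0 (w x)).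
    have /= e1 := congr1 (@^~ x) R1E; have /= e2 := congr1 (@^~ x) source.
    by rewrite /= (bopB b0) -e1 e2 subrr.
  by rewrite R0_ker.
have [C C0 hC] := bop_bounded bR; have [W W0 hW] := bop_bounded w_bounded.
have hM : schatten_bound p w M by apply/schattenP => //; exact: ltW.
have rate : bigO_P P (fun n o => (schatten p (Phi n o - adjoint rho) ^+ 2)%E)
    (fun n => gamma n / alpha n ^+ 3 + alpha n).
  apply: (bigO_P_transfer gamma_gt0 R0h_rate R1h_rate) => K K0.
  (* The constant of [rate_bound] for the coefficients [8 (1 + C)], [4 M] and [2 W] that
     [tikhonov_error] produces when [d0 = d1 = s]. *)
  exists (3 * ((8 * (1 + C)) ^+ 2 * K + (4 * M) ^+ 2 + (2 * W) ^+ 2 * K)).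
  (* Eventually [gamma n <= 1], as [rate_bound] requires. *)
  have /cvgrPdist_le/(_ _ ltr01) := gamma_cvg0.
  apply: filterS => n; rewrite sub0r normrN gtr0_norm// => g1 o h0 h1.
  set s := Num.sqrt (K * gamma n).
  have s0 : 0 <= s by exact: sqrtr_ge0.
  have sb (D : H -> H) : bounded_op D -> (schatten p D ^+ 2 <= (K * gamma
    n)%:E)%E ->
      schatten_bound p D s.
    by move=> bD' h; apply/schattenP => //; apply: lee_sqr_sqrt => //;
      exact: schatten_ge0.
  have e0 := sb _ (bop_sub (bA n o) b0) h0.
  have e1 := sb _ (bop_sub (bB n o) b1) h1.
  have := tikhonov_error p_ge1 (alpha_gt0 n) (R0h_class n o).1 (R0h_self n o)
    (bB n o) b0 b1 bR w_bounded R1E rhoE s0 s0 (ltW M_gt0) C0 W0 hC hW e0 e1 hM.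
  rewrite -Phi_def; set E := (X in schatten_bound _ _ X) => hE.
  have EE : E = 8 * (1 + C) * (s / Num.sqrt (alpha n)) +
      4 * M * Num.sqrt (alpha n) + 2 * W * s by rewrite /E; ring.
  have E0 : 0 <= E.
    have sa : 0 <= Num.sqrt (alpha n) by exact: sqrtr_ge0.
    by rewrite EE !addr_ge0// !mulr_ge0 ?invr_ge0 ?addr_ge0// ltW.
  apply: (@le_trans _ _ (E ^+ 2)%:E).
    by apply: lee_sqr => //; [exact: schatten_ge0|apply/schattenP].
  by rewrite lee_fin EE; exact: rate_bound.
have adjE n o : schatten p (Phi n o - adjoint rho) = schatten p (adjoint (Phi n
  o) - rho).
  rewrite -(schatten_adjoint p_ge1 (bD n o)).
  by rewrite (adjoint_sub (bPhi n o) bR') (adjointK bR).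
split; [by move=> n o; rewrite adjE|exact: rate|].
move=> /cvgrPdist_lt/(_ (1 / 2))/(_ _)/wrap[|alphaE]; first by lra.
apply/bigO_PP => e e0; have /bigO_PP/(_ e e0)[D hD] := rate.
(* [10] is the constant of [optimal_rate]; the absolute value covers a negative [D]. *)
exists (`|D| * 10); move: alphaE hD; apply: filterS2 => n hn.
apply: le_trans; apply: le_mu_ext => o /=; apply: le_lt_trans.
rewrite lee_fin -mulrA; have := optimal_rate (gamma_gt0 n) (alpha_gt0 n) hn.
move=> /(ler_wpM2l (normr_ge0 D)); apply: le_trans.
have r0 : 0 <= gamma n / alpha n ^+ 3 + alpha n.
  by rewrite addr_ge0 ?divr_ge0 ?exprn_ge0 ?(ltW (alpha_gt0 n)) ?(ltW
    (gamma_gt0 n)).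
exact: (ler_wpM2r r0 (ler_norm D)).
Qed.
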